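(* Let $p$ be a prime, let $m$ be a positive integer with $\gcd(p,m)=1$, let $k$ be a nonnegative integer, and let $n=p^km$ (with $n\geq 2$). Then, in $\mathbb{Z}_p[x,y]$: (i) if $m=1$ (so $k\ge1$), $\Psi_n(x,y)\equiv (x^2+4y^2)^{\varphi(p^k)/2}$ (for $p=2$, $k=1$ this is to be read as $\Psi_2(x,y)=x$, since $x^2+4y^2\equiv x^2$ modulo $2$); (ii) if $m=2$, $\Psi_n(x,y)\equiv x^{\varphi(p^k)}$; (iii) if $m\geq 3$ and $p>2$, then with $\delta$ as defined below for odd $p$, $\Psi_n(x,y)$ factors as a product of $\varphi(m)/\delta$ distinct irreducible homogeneous polynomials of degree $\delta$, monic in $x$, each raised to the power $\varphi(p^k)$; (iv) if $m\geq 3$ and $p=2$, then with $\delta$ as defined below for $p=2$, $\Psi_n(x,y)$ factors as a product of $\varphi(m)/(2\delta)$ distinct irreducible homogeneous polynomials of degree $\delta$, monic in $x$, each raised to the power $2\varphi(2^k)$. Definition of $\delta$ for odd $p$ and $m\ge3$, $\gcd(p,m)=1$: let $u$ be the multiplicative order of $p$ modulo $2m$. Then $\delta=u/2$ if either ($p\equiv1\pmod 4$, $u$ even, and $p^{u/2}\equiv-1\pmod{2m}$), or ($p\equiv 3\pmod 4$, $u\equiv 0\pmod 4$, and $p^{u/2}\equiv -1\pmod{2m}$), or ($p\equiv3\pmod4$, $u\equiv 2\pmod 4$, and $p^{u/2}\equiv m\pm1\pmod{2m}$); $\delta=2u$ if $p\equiv 3\pmod 4$ and $u$ is odd; and $\delta=u$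 in all remaining cases. Definition of $\delta$ for $p=2$ and odd $m\geq3$: let $u'$ be the multiplicative order of $2$ modulo $m$. Then $\delta=u'/2$ if $u'$ is even and $2^{u'/2}\equiv-1\pmod m$, and $\delta=u'$ otherwise.
   Context: The Fibonacci polynomials are defined by $F_1(x)=1$, $F_2(x)=x$, and $F_n(x)=xF_{n-1}(x)+F_{n-2}(x)$ for $n\geq 3$. For $n\geq 2$, the $n$-th fibotomic polynomial $\Psi_n(x)\in\mathbb{Z}[x]$ is the product of the monic irreducible factors of $F_n(x)$ which are not factors of $F_k(x)$ for any $k<n$; also $\Psi_1(x)=1$. Thus $F_n(x)=\prod_{d\mid n}\Psi_d(x)$ for all $n\geq1$, and for $n\geq 2$, $\Psi_n(x)$ is monic of degree $\varphi(n)$, where $\varphi$ is Euler's totient function. The homogenized fibotomic polynomials are $\Psi_1(x,y)=1$ and $\Psi_n(x,y)=y^{\varphi(n)}\Psi_n(x/y)$ for $n\geq2$. $\mathbb{Z}_p$ denotes the field with $p$ elements, and factorization ''in $\mathbb{Z}_p[x,y]$'' refers to the reduction of the integer polynomial modulo $p$. *)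

(* Defs.v *)
From HB Require Import structures.
From mathcomp Require Import all_boot all_order all_algebra.
Set Implicit Arguments. Unset Strict Implicit. Unset Printing Implicit Defensive.
Import Order.TTheory GRing.Theory Num.Theory.
Local Open Scope ring_scope.

Fixpoint fibpair (n : nat) : {poly int} * {poly int} :=
  match n with
  | 0 => (0, 1)
  | n'.+1 => let (a, b) := fibpair n' in (b, 'X * b + a)
  end.
Definition fibpoly (n : nat) : {poly int} := (fibpair n).1.

Definition polyQ (P : {poly int}) : {poly rat} := map_poly (intr : int -> rat) P.

(* Psi is the n-th fibotomic polynomial: Psi_1 = 1, and for n >= 2 Psi is the
   product (each taken once) of the monic irreducible factors of F_n which do
   not divide any F_k, 1 <= k < n.  Factors are taken over Q (by Gauss' lemma
   the monic irreducible factors of the monic F_n in Z[x] and in Q[x] agree).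
   "Product of these factors, each once" is expressed as: Psi monic, squarefree,
   and its monic irreducible divisors are exactly these factors. *)
Definition is_fibotomic (n : nat) (Psi : {poly int}) : Prop :=
  if (n <= 1)%N then Psi = 1 else
  [/\ Psi \is monic,
      (forall q : {poly rat}, q \is monic -> irreducible_poly q ->
          ~~ (q ^+ 2 %| polyQ Psi)) &
      (forall q : {poly rat}, q \is monic -> irreducible_poly q ->
          (q %| polyQ Psi) =
          ((q %| polyQ (fibpoly n)) &&
           [forall k : 'I_n, (0 < k)%N ==> ~~ (q %| polyQ (fibpoly k))]))].

(* Bivariate polynomials over a ring R: {poly {poly R}}, outer variable x,
   inner variable y.  The variable y is ('X)%:P. *)
Definition yvar (R : nzRingType) : {poly {poly R}} := ('X : {poly R})%:P.

Definition homogenize (R : nzRingType) (d : nat) (P : {poly R}) : {poly {poly R}} :=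
  \poly_(i < d.+1) (P`_i *: 'X^(d - i)).

Definition homogeneous (R : nzRingType) (d : nat) (P : {poly {poly R}}) : Prop :=
  forall i j : nat, (P`_i)`_j != 0 -> (i + j)%N = d.

Definition irreducible_elt (R : idomainType) (a : R) : Prop :=
  [/\ a != 0, a \isn't a GRing.unit &
      forall b c : R, a = b * c -> b \is a GRing.unit \/ c \is a GRing.unit].

Local Close Scope ring_scope.

(* Multiplicative order of a modulo N (for a coprime to N, N >= 2): the least
   u >= 1 with a^u = 1 (mod N); it lies in [1, N]. *)
Definition ordmod (a N : nat) : nat :=
  nth 0%N [seq u <- iota 1 N | a ^ u == 1 %[mod N]] 0.

Definition delta_odd (p m : nat) : nat :=
  let u := ordmod p (2 * m) in
  let h := (p ^ (u %/ 2)) %% (2 * m) in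
  if [|| [&& p %% 4 == 1, ~~ odd u & h == (2 * m).-1],
         [&& p %% 4 == 3, u %% 4 == 0 & h == (2 * m).-1] |
         [&& p %% 4 == 3, u %% 4 == 2 & (h == m.+1) || (h == m.-1)]]
  then (u %/ 2)%N
  else if (p %% 4 == 3) && odd u then (2 * u)%N
  else u.

Definition delta_two (m : nat) : nat :=
  let u := ordmod 2 m in
  if ~~ odd u && ((2 ^ (u %/ 2)) %% m == m.-1) then (u %/ 2)%N else u.

(* Main.v *)
Require Import Defs.
From HB Require Import structures.
From mathcomp Require Import all_boot all_order all_algebra all_solvable all_field.
From mathcomp Require Import zify ring.
From Stdlib Require Import Classical_Prop.
Import Order.TTheory GRing.Theory Num.Theory.
Set Implicit Arguments.
Unset Strict Implicit.
Unset Printing Implicit Defensive.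
Local Open Scope ring_scope.

(** Substituting x = t - 1/t turns the Fibonacci polynomials into
    F_n(t - 1/t) t^(n-1) (t^2 + 1) = t^(2n) - (-1)^n, so that
    t^phi(n) Psi_n(t - 1/t) = +- Phi_n(-t^2) with Phi_n the cyclotomic
    polynomial.  The map P |-> t^d P(t - 1/t) is multiplicative and injective,
    hence identities modulo p between cyclotomic polynomials, in particular
    Phi_(p^k m) = Phi_m^phi(p^k), descend to the Psi_n.  A root theta = t - 1/t
    of Psi_m in characteristic p has -t^2 a primitive m-th root of unity, and
    theta^Q = theta for Q = p^e iff t^(Q-1) = 1 or t^(Q+1) = -1; this is a
    congruence condition on Q whose least solution e, which is the degree of
    every irreducible factor of Psi_m modulo p, is delta.  For p = 2 the
    polynomial Psi_m is the square of a separable polynomial. *)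

(** * Homogenization *)

(** [homogenize] and [joukowski] take the formal degree [d] as an argument instead of reading it off
    the polynomial, so that degrees add under products whatever happens to leading coefficients. The
    second is the first evaluated at x = t^2 - 1, y = t, so multiplicativity is proved once for
    both. The obstacle is that Psi_n is specified by its irreducible factors over Q, which says
    nothing modulo p. An integral polynomial with image +-Phi_n(-t^2) is therefore constructed
    independently and then identified with Psi_n over Q. Its existence is not automatic, since the
    images of integral polynomials form a proper subset of Z[t]; it is obtained as a quotient of F_n
    by the solutions of smaller index. The map t |-> t - 1/t has fibres {t, -1/t}, whence the
    alternative t^(Q-1) = 1 or t^(Q+1) = -1. It ramifies where t^2 = -1, that is over theta^2 = -4.
    Accordingly t^2 + 1, the factor belonging to n = 1, is not the image of an integral polynomial,
    but its square is the image of x^2 + 4: this is why m = 1 is a case apart. *)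

Lemma coef_homogenize (R : nzRingType) d (P : {poly R}) i :
  (size P <= d.+1)%N -> (homogenize d P)`_i = P`_i *: 'X^(d - i).
Proof.
move=> sP; rewrite coef_poly; case: ltnP => // di.
by rewrite nth_default ?scale0r // (leq_trans sP).
Qed.

Lemma size_mul_leqS (R : nzSemiRingType) d e (P Q : {poly R}) :
  (size P <= d.+1)%N -> (size Q <= e.+1)%N -> (size (P * Q)%R <= (d + e).+1)%N.
Proof.
move=> sP sQ; apply: leq_trans (size_polyMleq _ _) _.
by rewrite -subn1 leq_subLR add1n -addnS -addSn leq_add.
Qed.

Lemma homogenizeM (R : comNzRingType) d e (P Q : {poly R}) :
  (size P <= d.+1)%N -> (size Q <= e.+1)%N ->
  homogenize (d + e) (P * Q) = homogenize d P * homogenize e Q.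
Proof.
move=> sP sQ; apply/polyP => i; rewrite coef_homogenize; last first.
  exact: size_mul_leqS.
rewrite !coefM scaler_suml; apply: eq_bigr => j _.
rewrite !coef_homogenize //.
(* Beyond the formal degrees the truncated exponents [d - j] and [e - (i - j)] no longer add up, but
   there the coefficients vanish. *)
have [dj|jd] := ltnP d j.
  by rewrite [P`_j]nth_default ?(leq_trans sP) // mul0r !scale0r mul0r.
have [ei|ie] := ltnP e (i - j).
  by rewrite [Q`__]nth_default ?(leq_trans sQ) // mulr0 !scale0r mulr0.
rewrite -scalerAl -scalerAr scalerA -exprD; congr (_ *: 'X^_).
have := ltn_ord j; lia.
Qed.

Lemma homogenize1 (R : nzRingType) : homogenize 0 (1 : {poly R}) = 1.
Proof. by rewrite /homogenize poly_def big_ord1 coef1 expr0 !scale1r. Qed.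

Lemma homogenizeX (R : comNzRingType) d (P : {poly R}) n :
  (size P <= d.+1)%N -> homogenize (d * n) (P ^+ n) = homogenize d P ^+ n.
Proof.
move=> sP; elim: n => [|n IHn]; first by rewrite muln0 !expr0 homogenize1.
rewrite mulnS !exprS homogenizeM ?IHn //.
apply: leq_trans (size_poly_exp_leq _ _) _.
by rewrite ltnS leq_mul2r; apply/orP; right; case: (size P) sP.
Qed.

Lemma homogenize_prod (R : comNzRingType) (I : eqType) (r : seq I)
    (d : I -> nat) (P : I -> {poly R}) :
  (forall i, i \in r -> (size (P i) <= (d i).+1)%N) ->
  homogenize (\sum_(i <- r) d i) (\prod_(i <- r) P i)
    = \prod_(i <- r) homogenize (d i) (P i).
Proof.
elim: r => [|i r IHr] sP; first by rewrite !big_nil homogenize1.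
rewrite !big_cons homogenizeM ?IHr ?sP ?mem_head //.
  by move=> j jr; apply: sP; rewrite in_cons jr orbT.
rewrite !big_seq.
elim/big_rec2: _ => [|j n Q jr sQ]; first by rewrite size_poly1.
apply: leq_trans (size_polyMleq _ _) _.
by have := sP j; rewrite in_cons jr orbT => /(_ isT); lia.
Qed.

Lemma homogeneous_homogenize (R : nzRingType) d (P : {poly R}) :
  (size P <= d.+1)%N -> homogeneous d (homogenize d P).
Proof.
move=> sP i j; rewrite coef_homogenize // coefZ coefXn.
case: (j =P _) => [->|_]; last by rewrite mulr0 eqxx.
rewrite mulr1 => Pi; apply: subnKC; rewrite leqNgt; apply: contra Pi => di.
by rewrite nth_default // (leq_trans sP).
Qed.

Lemma size_homogenize_monic (R : nzRingType) d (P : {poly R}) :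
  P \is monic -> size P = d.+1 ->
  size (homogenize d P) = d.+1 /\ homogenize d P \is monic.
Proof.
move=> mP sP.
have Hd : (homogenize d P)`_d = 1.
  rewrite coef_homogenize ?sP // subnn expr0.
  by move: mP; rewrite monicE lead_coefE sP => /eqP ->; rewrite scale1r.
have sH : size (homogenize d P) = d.+1.
  apply/eqP; rewrite eqn_leq size_poly ltnNge; apply/negP => /leq_sizeP/(_ d).
  by rewrite leqnn => /(_ isT); rewrite Hd; apply/eqP; rewrite oner_eq0.
by split=> //; rewrite monicE lead_coefE sH Hd.
Qed.

Lemma dehomogenizeK (R : comNzRingType) d (P : {poly R}) :
  (size P <= d.+1)%N -> map_poly (horner_eval 1) (homogenize d P) = P.
Proof.
move=> sP; apply/polyP => i; rewrite coef_map /= coef_homogenize //.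
by rewrite /horner_eval hornerZ hornerXn expr1n mulr1.
Qed.

(* A factorization of the homogenization has constant leading coefficients in
   x, so setting y = 1 turns it into a factorization of q with the same
   degrees. *)
Lemma irreducible_homogenize (F : fieldType) d (q : {poly F}) :
  q \is monic -> size q = d.+1 -> irreducible_poly q ->
  irreducible_elt (homogenize d q).
Proof.
move=> mq sq irr_q; have [sH mH] := size_homogenize_monic mq sq.
have d_gt0 : (0 < d)%N by have := irr_q.1; rewrite sq.
split; first exact: monic_neq0.
  by apply/negP; rewrite poly_unitE sH eqSS => /andP[/eqP d0]; rewrite d0 in d_gt0.
move=> b c bc.
have lbc : lead_coef b * lead_coef c = 1 by rewrite -lead_coefM -bc (monicP mH).
have ub : lead_coef b \is a GRing.unit.
  by apply/unitrPr; exists (lead_coef c).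
have uc : lead_coef c \is a GRing.unit.
  by apply/unitrPr; exists (lead_coef b); rewrite mulrC.
have unit1 (e : {poly {poly F}}) : lead_coef e \is a GRing.unit ->
    size e = 1%N -> e \is a GRing.unit.
  by rewrite lead_coefE => + se; rewrite [e \is a _]poly_unitE se.
have sz (e : {poly {poly F}}) : lead_coef e \is a GRing.unit ->
    size (map_poly (horner_eval 1) e) = size e.
  rewrite poly_unitE => /andP[/eqP/eqP/size_poly1P[x x0 le] _].
  rewrite size_poly_eq // -?lead_coefE le /horner_eval hornerC //.
have qbc : q = map_poly (horner_eval 1) b * map_poly (horner_eval 1) c.
  by rewrite -rmorphM /= -bc dehomogenizeK ?sq.
have [sb|sb] := eqVneq (size (map_poly (horner_eval 1) b)) 1%N.
  by left; apply: unit1 => //; rewrite -sz.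
right; apply: unit1 => //; rewrite -sz //.
have nz (e : {poly {poly F}}) : lead_coef e \is a GRing.unit ->
    map_poly (horner_eval 1) e != 0.
  move=> ue; rewrite -size_poly_gt0 sz // size_poly_gt0.
  by apply: contraTneq ue => ->; rewrite lead_coef0 unitr0.
have b_q : map_poly (horner_eval 1) b %| q by rewrite qbc dvdp_mulIl.
have := eqp_size (irr_q.2 _ sb b_q).
rewrite {1}qbc size_mul ?nz //.
have := nz b ub; rewrite -size_poly_gt0.
have := nz c uc; rewrite -size_poly_gt0.
by case: (size _) => // k _; case: (size _) => // l _ /=; lia.
Qed.

(** * Squarefree polynomials *)

(** Induction on the size. Irreducibility over an arbitrary field is not a boolean test, so
    [classic] decides whether [P] splits; if it does, a proper divisor is made monic and both
    factors are smaller. *)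
Lemma monic_irreducible_factors (F : fieldType) (P : {poly F}) :
  P \is monic ->
  exists2 s : seq {poly F},
    forall q, q \in s -> q \is monic /\ irreducible_poly q
    & P = \prod_(q <- s) q.
Proof.
have [n] := ubnP (size P); elim: n P => // n IHn P /ltnSE sPn mP.
have [sP|sP] := eqVneq (size P) 1%N.
  exists [::]; rewrite // big_nil; move: mP; rewrite monicE lead_coefE sP => /eqP P1.
  by rewrite (size1_polyC (eq_leq sP)) P1.
have [irrP|irrP] := classic (irreducible_poly P).
  by exists [:: P]; rewrite ?big_seq1 // => q; rewrite inE => /eqP ->.
have [q [sq qP qP']] : exists q : {poly F}, [/\ size q != 1%N, q %| P & ~~ (q %= P)].
  apply: NNPP => nq; apply: irrP; split.
    rewrite ltn_neqAle eq_sym sP size_poly_gt0 monic_neq0 //.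
  move=> q sq qP; apply: contraT => qP'; case: nq; by exists q.
have q0 : q != 0 by apply: contraTneq qP => ->; rewrite dvd0p monic_neq0.
pose q1 := (lead_coef q)^-1 *: q.
have lq0 : (lead_coef q)^-1 != 0 by rewrite invr_eq0 lead_coef_eq0.
have mq1 : q1 \is monic by rewrite monicE lead_coefZ mulVf // lead_coef_eq0.
have q1q : q1 %= q by apply: eqp_scale.
have sq1 : size q1 = size q by rewrite size_scale.
have DP : P = P %/ q1 * q1 by rewrite divpK // (eqp_dvdl _ q1q).
have mr : P %/ q1 \is monic by move: mP; rewrite {1}DP monicMr.
have ltq : (size q1 < size P)%N.
  by rewrite sq1 ltn_neqAle dvdp_leq ?monic_neq0 // dvdp_size_eqp // qP'.
have ltr : (size (P %/ q1)%R < size P)%N.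
  rewrite size_divp ?monic_neq0 // sq1 ltn_subrL.
  by rewrite size_poly_gt0 monic_neq0 // -(subnKC (_ : 1 < size q)%N) //
     ltn_neqAle eq_sym sq size_poly_gt0.
have [s1 s1P Ds1] := IHn _ (leq_trans ltq sPn) mq1.
have [s2 s2P Ds2] := IHn _ (leq_trans ltr sPn) mr.
exists (s2 ++ s1); last by rewrite big_cat /= -Ds1 -Ds2.
by move=> r; rewrite mem_cat => /orP[/s2P|/s1P].
Qed.

(** The irreducible factors of a squarefree [P] are pairwise coprime, so their product divides
    whatever each of them divides. Used in both directions, this identifies two monic squarefree
    polynomials with the same irreducible divisors. *)
Lemma squarefree_dvdp (F : fieldType) (P S : {poly F}) :
  P \is monic ->
  (forall q, q \is monic -> irreducible_poly q -> q %| P ->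
     ~~ (q ^+ 2 %| P) /\ q %| S) ->
  P %| S.
Proof.
case/monic_irreducible_factors => s sP ->.
elim: s sP => [|q s IHs] sP sqf; first by rewrite big_nil dvd1p.
have [mq irrq] := sP q (mem_head _ _).
rewrite big_cons Gauss_dvdp; last first.
  (* If [q] divided the product of the remaining factors, its square would divide the whole. *)
  rewrite irreducible_poly_coprime //; apply: contraL isT => qs.
  case: (sqf q mq irrq); first by rewrite big_cons dvdp_mulIl.
  by rewrite big_cons expr2 dvdp_mul2l ?qs ?monic_neq0.
apply/andP; split; first by apply: (sqf q mq irrq _).2; rewrite big_cons dvdp_mulIl.
apply: IHs => [r rs|r mr irrr rs]; first by apply: sP; rewrite in_cons rs orbT.
case: (sqf r mr irrr); first by rewrite big_cons dvdp_mull.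
by move=> nr rS; split=> //; apply: contra nr => nr; rewrite big_cons dvdp_mull.
Qed.

Lemma uniq_squarefree_prod (F : fieldType) (s : seq {poly F}) :
  (forall q, q \in s -> q \is monic /\ irreducible_poly q) ->
  (forall q, irreducible_poly q -> ~~ (q ^+ 2 %| \prod_(r <- s) r)) ->
  uniq s.
Proof.
elim: s => //= q s IHs sP sqf; apply/andP; split.
  apply/negP => qs; have [mq irrq] := sP q (mem_head _ _).
  have q_s : q %| \prod_(r <- s) r by rewrite (big_rem q qs) dvdp_mulIl.
  by have := sqf q irrq; rewrite big_cons expr2 dvdp_mul2l ?q_s ?monic_neq0.
apply: IHs => [r rs|r irrr]; first by apply: sP; rewrite in_cons rs orbT.
by apply: contra (sqf r irrr) => r2; rewrite big_cons dvdp_mull.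
Qed.

(** * The substitution t - 1/t *)

(* [joukowski d P] is t^d P(t - 1/t). *)
Definition joukowski (R : comNzRingType) d (P : {poly R}) : {poly R} :=
  (homogenize d P).['X^2 - 1].

Lemma joukowskiE (R : comNzRingType) d (P : {poly R}) :
  joukowski d P = \sum_(i < d.+1) P`_i *: ('X^(d - i) * ('X^2 - 1) ^+ i).
Proof.
by rewrite /joukowski horner_poly; apply: eq_bigr => i _; rewrite scalerAl.
Qed.

Lemma joukowski1 (R : comNzRingType) : joukowski 0 (1 : {poly R}) = 1.
Proof. by rewrite /joukowski homogenize1 hornerC. Qed.

Lemma joukowskiM (R : comNzRingType) d e (P Q : {poly R}) :
  (size P <= d.+1)%N -> (size Q <= e.+1)%N ->
  joukowski (d + e) (P * Q) = joukowski d P * joukowski e Q.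
Proof. by move=> sP sQ; rewrite /joukowski homogenizeM // hornerM. Qed.

Lemma joukowski_exp (R : comNzRingType) d (P : {poly R}) n :
  (size P <= d.+1)%N -> joukowski (d * n) (P ^+ n) = joukowski d P ^+ n.
Proof. by move=> sP; rewrite /joukowski homogenizeX // horner_exp. Qed.

Lemma joukowski_prod (R : comNzRingType) (I : eqType) (r : seq I) (P : pred I)
    (d : I -> nat) (S : I -> {poly R}) :
  (forall i, i \in r -> P i -> (size (S i) <= (d i).+1)%N) ->
  joukowski (\sum_(i <- r | P i) d i) (\prod_(i <- r | P i) S i)
    = \prod_(i <- r | P i) joukowski (d i) (S i).
Proof.
move=> sS; rewrite -big_filter -(big_filter r P S).
rewrite -(big_filter r P (fun i => joukowski (d i) (S i))).
rewrite /joukowski homogenize_prod ?horner_prod // => i.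
by rewrite mem_filter => /andP[Pi ri]; apply: sS.
Qed.

Lemma joukowskiB (R : comNzRingType) d (P Q : {poly R}) :
  joukowski d (P - Q) = joukowski d P - joukowski d Q.
Proof.
rewrite !joukowskiE -sumrB; apply: eq_bigr => i _.
by rewrite coefB scalerBl.
Qed.

Lemma map_joukowski (R S : comNzRingType) (f : {rmorphism R -> S}) d P :
  map_poly f (joukowski d P) = joukowski d (map_poly f P).
Proof.
rewrite !joukowskiE rmorph_sum /=; apply: eq_bigr => i _.
rewrite map_polyZ /= rmorphM rmorphXn rmorphXn rmorphB rmorphXn /=.
by rewrite map_polyX rmorph1 coef_map.
Qed.

(** The relation between [t] and [theta] is theta = t - 1/t cleared of its denominator; it forces
    [t] to be nonzero. *)
Lemma horner_joukowski (R : comNzRingType) d (P : {poly R}) (t theta : R) :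
  (size P <= d.+1)%N -> t ^+ 2 - 1 = theta * t ->
  (joukowski d P).[t] = t ^+ d * P.[theta].
Proof.
move=> sP tt; rewrite joukowskiE horner_sum (horner_coef_wide _ sP) mulr_sumr.
apply: eq_bigr => i _; rewrite hornerZ hornerM hornerXn horner_exp !hornerE tt exprMn.
have -> : t ^+ d = t ^+ (d - i) * t ^+ i by rewrite -exprD subnK // -ltnS.
by rewrite /=; ring.
Qed.

(** The summand of index i is a multiple of the monic polynomial t^(d-i) (t^2 - 1)^i of degree d +
    i, so the degrees of the summands are distinct and the leading term of [P] dominates.
    Injectivity follows. *)
Lemma size_joukowski (R : idomainType) d (P : {poly R}) :
  P != 0 -> (size P <= d.+1)%N ->
  size (joukowski d P) = (d + size P)%N /\
  lead_coef (joukowski d P) = lead_coef P.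
Proof.
move=> P0 sP; have sX i : (i <= d)%N ->
    size ('X^(d - i) * ('X^2 - 1) ^+ i : {poly R}) = (d + i).+1 /\
    lead_coef ('X^(d - i) * ('X^2 - 1) ^+ i : {poly R}) = 1.
  move=> di; have mX : ('X^2 - 1 : {poly R}) \is monic by rewrite monicXnsubC.
  have mXi : (('X^2 - 1) ^+ i : {poly R}) \is monic by rewrite monic_exp.
  split; last by apply/monicP; rewrite monicMl ?monicXn.
  rewrite size_monicM ?monicXn ?monic_neq0 // size_polyXn.
  have := size_exp ('X^2 - 1 : {poly R}) i; rewrite size_XnsubC //=.
  have : (0 < size (('X^2 - 1) ^+ i : {poly R})%R)%N by rewrite size_poly_gt0 monic_neq0.
  case: (size _) => // k _ /= ->; lia.
have [n sPn] : exists n, size P = n.+1.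
  by exists (size P).-1; rewrite prednK ?size_poly_gt0.
have nd : (n <= d)%N by rewrite sPn in sP.
have -> : joukowski d P = \sum_(i < n.+1) P`_i *: ('X^(d - i) * ('X^2 - 1) ^+ i).
  rewrite joukowskiE.
  rewrite [RHS](big_ord_widen d.+1 (fun i => P`_i *: ('X^(d - i) * ('X^2 - 1) ^+ i))) //.
  rewrite [RHS]big_mkcond /=; apply: eq_bigr => i _; case: ltnP => // ni.
  by rewrite nth_default ?scale0r // sPn.
have Pn0 : P`_n != 0 by rewrite -[n]/(n.+1.-1) -sPn -lead_coefE lead_coef_eq0.
rewrite big_ord_recr /= addrC.
have lt : (size (\sum_(i < n) P`_i *: ('X^(d - i) * ('X^2 - 1) ^+ i))%R <
  size (P`_n *: ('X^(d - n) * ('X^2 - 1) ^+ n))%R)%N.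
  rewrite size_scale // (sX n nd).1 ltnS; apply: leq_trans (size_sum _ _ _) _.
  apply/bigmax_leqP => i _; apply: leq_trans (size_scale_leq _ _) _.
  by rewrite (sX i _).1 ?ltn_add2l // (leq_trans (ltnW (ltn_ord i))).
rewrite size_polyDl // lead_coefDl // lead_coefZ size_scale // (sX n nd).1 (sX n nd).2.
by rewrite sPn mulr1 addnS lead_coefE sPn.
Qed.

Lemma joukowski_inj (R : idomainType) d (P Q : {poly R}) :
  (size P <= d.+1)%N -> (size Q <= d.+1)%N ->
  joukowski d P = joukowski d Q -> P = Q.
Proof.
move=> sP sQ PQ; apply/eqP; rewrite -subr_eq0; apply: contraT => nPQ.
have sPQ : (size (P - Q)%R <= d.+1)%N.
  by rewrite (leq_trans (size_polyD _ _)) // geq_max sP size_polyN.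
have [] := size_joukowski nPQ sPQ; rewrite joukowskiB PQ subrr size_poly0.
by move=> /esym/eqP; rewrite addn_eq0 size_poly_eq0 (negPf nPQ) andbF.
Qed.

(** A polynomial with nonzero constant term has t-adic valuation 0, so multiplying by it does not
    change valuations. *)
Lemma coef_mul0_low (R : idomainType) (A H : {poly R}) k :
  A`_0 != 0 -> (forall i, (i < k)%N -> (A * H)`_i = 0) ->
  forall i, (i < k)%N -> H`_i = 0.
Proof.
move=> A0 AH; elim/ltn_ind => i IHi ik; have /eqP := AH i ik.
rewrite coefM big_ord_recl big1 /= => [|j _]; last first.
  by rewrite IHi ?mulr0 // /bump /=; have := ltn_ord j; lia.
by rewrite subn0 addr0 mulf_eq0 (negPf A0) => /eqP.
Qed.

(* The remainder r of the division of B by A satisfies J_a(A) H = J_b(r) where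
   t^(b-a+1) divides H, which is too large a degree unless r = 0. *)
Lemma joukowski_div (R : idomainType) a b (A B G : {poly R}) :
  A \is monic -> size A = a.+1 -> (a <= b)%N -> (size B <= b.+1)%N ->
  joukowski a A * G = joukowski b B ->
  exists C : {poly R}, [/\ (size C <= (b - a).+1)%N, B = C * A & joukowski (b - a) C = G].
Proof.
move=> mA sA ab sB AG.
set C := Pdiv.Ring.rdivp B A; pose r := Pdiv.Ring.rmodp B A.
have DB : B = C * A + r by apply: Pdiv.RingMonic.rdivp_eq.
have sr : (size r <= a)%N by rewrite -ltnS -sA Pdiv.Ring.ltn_rmodpN0 ?monic_neq0.
have sC : (size C <= (b - a).+1)%N.
  have [->|C0] := eqVneq C 0; first by rewrite size_poly0.
  have : (size (C * A)%R <= b.+1)%N.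
    have -> : C * A = B - r by rewrite DB addrK.
    rewrite (leq_trans (size_polyD _ _)) // geq_max sB size_polyN.
    by rewrite (leq_trans sr) // (leq_trans ab).
  by rewrite size_Mmonic // sA; move: (size C) => k; lia.
have sr' : (size r <= b.+1)%N by rewrite (leq_trans sr) // (leq_trans ab).
have DH : joukowski a A * (G - joukowski (b - a) C) = joukowski b r.
  have -> : r = B - C * A by rewrite DB addrC addKr.
  rewrite mulrBr AG joukowskiB; congr (_ - _).
  by rewrite mulrC -joukowskiM ?sA ?subnK.
(* At t = 0 only the summand of index [a] survives, with value (-1)^a times the leading coefficient
   1. *)
have A00 : (joukowski a A)`_0 != 0.
  rewrite -horner_coef0 joukowskiE horner_sum big_ord_recr big1 /= => [|i _].
    rewrite subnn hornerZ expr0 mul1r horner_exp !hornerE expr0n /= sub0r.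
    have := monicP mA; rewrite lead_coefE sA /= => ->.
    by rewrite mul1r signr_eq0.
  by rewrite hornerZ hornerM hornerXn expr0n subn_eq0 leqNgt ltn_ord /= mul0r mulr0.
(* Since [r] has degree below [a], each of its terms contributes a factor t^(b-j) with j < a. *)
have low i : (i < b - a + 1)%N -> (joukowski b r)`_i = 0.
  move=> ib; rewrite joukowskiE coef_sum big1 // => j _; rewrite coefZ coefXnM.
  have [ja|ja] := ltnP j a; last by rewrite nth_default ?mul0r // (leq_trans sr).
  by rewrite ifT ?mulr0 //; lia.
have r0 : r = 0.
  apply/eqP; apply: contraT => r0; have [] := size_joukowski r0 sr'.
  set H := G - _ in DH *.
  have H0 : H != 0.
    apply: contra_neq r0 => H0; move: DH; rewrite H0 mulr0 => /esym Jr.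
    apply: (@joukowski_inj _ b) => //; rewrite ?size_poly0 //.
    by rewrite Jr joukowskiE big1 // => i _; rewrite coef0 scale0r.
  have [sJ _] := size_joukowski (monic_neq0 mA) (eq_leq sA).
  rewrite -DH size_mul // -?size_poly_eq0 ?sJ ?sA ?addnS //.
  have Hlow := coef_mul0_low A00 (fun i lt =>
    eq_trans (congr1 (fun P : {poly R} => P`_i) DH) (low i lt)).
  have sH : (b - a + 1 < size H)%N.
    rewrite ltnNge; apply: contra H0 => sH; apply/eqP/polyP => i; rewrite coef0.
    by have [/Hlow//|ib] := ltnP i (b - a + 1); rewrite nth_default // (leq_trans sH).
  by move: (size H) (size r) sH sr => h k; lia.
exists C; split=> //; first by rewrite DB r0 addr0.
apply/eqP; rewrite eq_sym -subr_eq0 -(mulrI_eq0 _ (mulfI _ : GRing.lreg (joukowski a A))).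
  rewrite DH r0 joukowskiE big1 // => i _; by rewrite coef0 scale0r.
by apply: contraNneq A00 => ->; rewrite coef0.
Qed.

(** * Fibonacci and cyclotomic polynomials *)

Lemma joukowskiD (R : comNzRingType) d (P Q : {poly R}) :
  joukowski d (P + Q) = joukowski d P + joukowski d Q.
Proof.
rewrite !joukowskiE -big_split; apply: eq_bigr => i _.
by rewrite coefD scalerDl.
Qed.

Lemma fibpolyS n : fibpoly n.+2 = 'X * fibpoly n.+1 + fibpoly n.
Proof. by rewrite /fibpoly /=; case: (fibpair n). Qed.

Lemma fibpoly_monic n : size (fibpoly n.+1) = n.+1 /\ fibpoly n.+1 \is monic.
Proof.
elim/ltn_ind: n => -[_|[_|n IHn]]; first by rewrite size_poly1 monic1.
  by rewrite fibpolyS mulr1 addr0 size_polyX monicX.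
have [sF mF] := IHn n.+1 (ltnSn _); have [sF' _] := IHn n (ltnW (ltnSn _)).
have sXF : size ('X * fibpoly n.+2) = n.+3.
  by rewrite mulrC size_mulX ?monic_neq0 // sF.
rewrite fibpolyS size_polyDl ?sXF ?sF' //; split=> //.
by rewrite monicE lead_coefDl ?sXF ?sF' // -monicE monicMl ?monicX.
Qed.

Lemma joukowskiX1 (R : comNzRingType) : joukowski 1 ('X : {poly R}) = 'X^2 - 1.
Proof.
rewrite joukowskiE !big_ord_recl big_ord0 !coefX /= scale0r scale1r.
by rewrite add0r addr0 expr0 mul1r.
Qed.

(** Binet's formula: for x = t - 1/t the roots of z^2 = x z + 1 are t and -1/t, so F_(n+1) =
    (t^(n+1) - (-1/t)^(n+1)) / (t + 1/t). The proof checks the recurrence. *)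
Lemma joukowski_fibpoly n :
  joukowski n (fibpoly n.+1) * ('X^2 + 1) = 'X^(2 * n.+1) - (-1) ^+ n.+1.
Proof.
(* In the recurrence [fibpoly n.+1] occurs with formal degree [n.+2], two above its degree [n]; the
   excess costs a factor t^2. *)
have J1 d : joukowski d.+2 (1 : {poly int}) = 'X^2 * joukowski d 1.
  rewrite -[X in joukowski _ X]mulr1 -[d.+2]/(2 + d)%N joukowskiM ?size_poly1 //.
  congr (_ * _); rewrite joukowskiE big_ord_recl big1 /= => [|i _].
    by rewrite coef1 scale1r mulr1 addr0.
  by rewrite coef1 scale0r.
elim/ltn_ind: n => -[_|[_|n IHn]].
- by rewrite joukowski1 mul1r expr1 opprK.
- rewrite fibpolyS mulr1 addr0 joukowskiX1; ring.
rewrite fibpolyS joukowskiD.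
have [sF _] := fibpoly_monic n.+1; have [sF' _] := fibpoly_monic n.
rewrite -[X in joukowski X ('X * _)]/(1 + n.+1)%N joukowskiM ?size_polyX ?sF //.
rewrite joukowskiX1.
rewrite -[fibpoly n.+1]mul1r -[X in joukowski X (1 * _)]/(2 + n)%N.
rewrite joukowskiM ?size_poly1 ?sF' //.
rewrite J1 joukowski1 mulr1.
have := IHn n.+1 (ltnSn _); have := IHn n (ltnW (ltnSn _)).
set a := joukowski _ _; set b := joukowski _ _ => aE bE.
rewrite mulrDl -!mulrA aE bE !mulnS !exprD !exprS; ring.
Qed.

(* The sign makes it monic. *)
Definition twisted_cyclotomic n : {poly int} :=
  (-1) ^+ totient n *: ('Phi_n \Po - 'X^2).

Lemma sum_totient_divisors n : (0 < n)%N ->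
  (\sum_(d <- divisors n) totient d)%N = n.
Proof.
move=> n0; rewrite -{2}[n]sum_totient_dvd -(big_mkord (dvdn^~ n) totient).
rewrite -[RHS]big_filter; apply: perm_big; apply: uniq_perm; rewrite ?divisors_uniq //.
  by rewrite filter_uniq ?iota_uniq.
move=> d; rewrite mem_filter mem_index_iota /= -dvdn_divisors // ltnS.
by case: (boolP (d %| n)%N) => //= /(dvdn_leq n0) ->.
Qed.

(** Substitution of -t^2 in the factorization of X^n - 1; the signs collect to (-1)^n because the
    totients of the divisors of n sum to n. *)
Lemma prod_twisted_cyclotomic n : (0 < n)%N ->
  \prod_(d <- divisors n) twisted_cyclotomic d = 'X^(2 * n) - (-1) ^+ n.
Proof.
move=> n0; rewrite /twisted_cyclotomic scaler_prod.
rewrite -(big_morph (fun d => (-1 : int) ^+ d) (exprD _) (expr0 _)).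
rewrite sum_totient_divisors //.
rewrite -(rmorph_prod (comp_poly (- 'X^2 : {poly int}))) /= prod_Cyclotomic //.
rewrite comp_polyB comp_polyC comp_Xn_poly [X in X - 1%:P]exprNn -exprM.
rewrite scalerBr -(signr_odd int n) -(signr_odd {poly int} n); case: (odd n).
  by rewrite expr1 !scaleN1r mulN1r opprK polyC1 opprK.
by rewrite expr0 !scale1r mul1r.
Qed.

Lemma twisted_cyclotomic1 : twisted_cyclotomic 1 = 'X^2 + 1.
Proof.
have := prod_twisted_cyclotomic (isT : (0 < 1)%N).
by rewrite (_ : divisors 1 = [:: 1%N]) // big_seq1 => ->; rewrite expr1 opprK.
Qed.

Lemma bigD1_seq_cond (R : Type) (idx : R) (op : Monoid.com_law idx) (I : eqType)
    (r : seq I) (P : pred I) (j : I) (F : I -> R) :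
  j \in r -> uniq r -> P j ->
  \big[op/idx]_(i <- r | P i) F i
    = op (F j) (\big[op/idx]_(i <- r | P i && (i != j)) F i).
Proof.
move=> jr ur Pj; rewrite -big_filter (bigD1_seq j) ?filter_uniq //=.
  by rewrite big_filter_cond.
by rewrite mem_filter Pj.
Qed.

Lemma prod_twisted_cyclotomic_neq1 n :
  \prod_(d <- divisors n.+1 | d != 1%N) twisted_cyclotomic d
    = joukowski n (fibpoly n.+1).
Proof.
have X1 : ('X^2 + 1 : {poly int}) != 0.
  by rewrite -size_poly_eq0 -[1]opprK -polyCN size_XnsubC.
apply: (mulIf X1); rewrite joukowski_fibpoly -prod_twisted_cyclotomic //.
rewrite [RHS](bigD1_seq 1%N) ?divisors_uniq //=; last by rewrite -dvdn_divisors.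
rewrite mulrC; congr (_ * _).
by rewrite twisted_cyclotomic1.
Qed.

Lemma sum_totient_neq1 n :
  (\sum_(d <- divisors n.+1 | d != 1%N) totient d)%N = n.
Proof.
have := sum_totient_divisors (isT : (0 < n.+1)%N).
rewrite (bigD1_seq 1%N) ?divisors_uniq //=; last by rewrite -dvdn_divisors.
by rewrite (_ : totient 1 = 1%N) // add1n => -[].
Qed.

(** Working substitute for [is_fibotomic]: it involves no factorization and survives reduction
    modulo p. It is meant for n > 1; for n = 1 no integral [S] satisfies it, t^2 + 1 not being of
    the form t^2 - 1 + c t. *)
Definition fibotomic_sol n (S : {poly int}) :=
  [/\ S \is monic, size S = (totient n).+1 &
      joukowski (totient n) S = twisted_cyclotomic n].

Lemma monic_prod_size (R : nzRingType) (I : eqType) (r : seq I) (P : pred I)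
    (d : I -> nat) (S : I -> {poly R}) :
  (forall i, i \in r -> P i -> S i \is monic /\ size (S i) = (d i).+1) ->
  \prod_(i <- r | P i) S i \is monic /\
  size (\prod_(i <- r | P i) S i) = (\sum_(i <- r | P i) d i).+1.
Proof.
elim: r => [|i r IHr] SP; first by rewrite !big_nil monic1 size_poly1.
have [|mQ sQ] := IHr; first by move=> j jr; apply: SP; rewrite in_cons jr orbT.
rewrite !big_cons; case: ifP => // Pi.
have [mS sS] := SP i (mem_head _ _) Pi.
by rewrite monicMl // size_Mmonic ?monic_neq0 // sS sQ addSn addnS.
Qed.

(** The image of F_(n+2) is the product of the twisted cyclotomic polynomials over the divisors d >
    1 of n + 2. All of these but the last are images of solutions already found, so [joukowski_div]
    yields the missing one as an exact quotient over Z. *)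
Lemma fibotomic_sol_exists n :
  exists S : nat -> {poly int}, forall d, (1 < d <= n)%N -> fibotomic_sol d (S d).
Proof.
elim: n => [|[|n] [S SP]].
- by exists (fun=> 1) => d /andP[]; case: d.
- by exists (fun=> 1) => -[|[|d]].
pose P d := (d != 1%N) && (d != n.+2).
have PS d : d \in divisors n.+2 -> P d -> fibotomic_sol d (S d).
  rewrite -dvdn_divisors // => /[dup] dn /dvdn_leq /= dle /andP[d1 dn2].
  apply: SP; have := dvdn_gt0 _ dn; move: (dle isT) d1 dn2; lia.
pose a := (\sum_(d <- divisors n.+2 | P d) totient d)%N.
have totE : (a + totient n.+2 = n.+1)%N.
  rewrite addnC -[RHS]sum_totient_neq1.
  rewrite [RHS](@bigD1_seq_cond _ _ _ _ _ _ n.+2) ?divisors_uniq //.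
  by rewrite -dvdn_divisors.
pose A := \prod_(d <- divisors n.+2 | P d) S d.
have [mA sA] : A \is monic /\
    size A = a.+1.
  by apply: monic_prod_size => d dn Pd; case: (PS d dn Pd).
have JA : joukowski a A =
    \prod_(d <- divisors n.+2 | P d) twisted_cyclotomic d.
  rewrite joukowski_prod; last by move=> d dn Pd; case: (PS d dn Pd) => _ ->.
  rewrite [LHS]big_seq_cond [RHS]big_seq_cond.
  by apply: eq_bigr => d /andP[dn Pd]; case: (PS d dn Pd).
have [sF mF] := fibpoly_monic n.+1.
have AG : joukowski a A * twisted_cyclotomic n.+2 = joukowski n.+1 (fibpoly n.+2).
  rewrite JA mulrC -prod_twisted_cyclotomic_neq1.
  by rewrite [RHS](@bigD1_seq_cond _ _ _ _ _ _ n.+2) ?divisors_uniq // -dvdn_divisors.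
have [||C [sC FC JC]] := joukowski_div mA sA _ _ AG; rewrite ?sF //.
  by move: totE; lia.
have mC : C \is monic by move: mF; rewrite FC monicMr.
exists (fun d => if d == n.+2 then C else S d) => d /andP[d1 dn].
case: eqP => [->|/eqP dn2]; last by apply: SP; move: dn dn2 d1; lia.
have sC' : size C = (totient n.+2).+1.
  move: sF; rewrite FC size_Mmonic ?monic_neq0 // sA addnS /= => H.
  by apply: (@addIn a); rewrite H addSn addnC totE.
by split=> //; rewrite -JC; congr joukowski; move: totE; lia.
Qed.

Lemma fibpoly_prod n (S : nat -> {poly int}) N :
  (forall d, (1 < d <= n)%N -> fibotomic_sol d (S d)) -> (N < n)%N ->
  fibpoly N.+1 = \prod_(d <- divisors N.+1 | d != 1%N) S d.
Proof.
move=> SP Nn.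
have PS d : d \in divisors N.+1 -> d != 1%N -> fibotomic_sol d (S d).
  rewrite -dvdn_divisors // => /[dup] dn /dvdn_leq /= dle d1.
  apply: SP; have := dvdn_gt0 _ dn; move: (dle isT) d1; lia.
have [sF mF] := fibpoly_monic N.
apply: (@joukowski_inj _ N); rewrite ?sF //.
  rewrite -[X in (_ <= X.+1)%N]sum_totient_neq1.
  have [|_ sS] := @monic_prod_size _ _ (divisors N.+1) (fun d => d != 1%N) totient S.
    by move=> d dn Pd; case: (PS d dn Pd).
  by rewrite sS.
rewrite -prod_twisted_cyclotomic_neq1 -[X in joukowski X]sum_totient_neq1.
rewrite joukowski_prod; last by move=> d dn Pd; case: (PS d dn Pd) => _ ->.
rewrite [LHS]big_seq_cond [RHS]big_seq_cond.
by apply: eq_bigr => d /andP[dn Pd]; case: (PS d dn Pd).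
Qed.

(** * Characterization of the fibotomic polynomials *)

Lemma irreducible_dvdpM (F : fieldType) (q a b : {poly F}) :
  irreducible_poly q -> q %| a * b -> q %| a \/ q %| b.
Proof.
move=> irrq qab; case: (boolP (q %| a)) => [|nqa]; [by left | right].
by move: qab; rewrite Gauss_dvdpr // irreducible_poly_coprime.
Qed.

Lemma irreducible_dvdp_prod (F : fieldType) (I : eqType) (r : seq I) (P : pred I)
    (S : I -> {poly F}) (q : {poly F}) :
  irreducible_poly q -> q %| \prod_(i <- r | P i) S i ->
  exists i, [/\ i \in r, P i & q %| S i].
Proof.
move=> irrq; elim: r => [|i r IHr].
  by rewrite big_nil dvdp1 => /eqP sq; have := irrq.1; rewrite sq.
rewrite big_cons; case: ifP => [Pi|_].
  case/(irreducible_dvdpM irrq) => [qi|/IHr[j [jr Pj qj]]].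
    by exists i; rewrite mem_head.
  by exists j; rewrite in_cons jr orbT.
by case/IHr=> j [jr Pj qj]; exists j; rewrite in_cons jr orbT.
Qed.

Lemma separable_XnsubC (F : fieldType) n (c : F) :
  n%:R != 0 :> F -> c != 0 -> separable_poly ('X^n - c%:P).
Proof.
case: n => [/eqP// | n nz_n nz_c]; rewrite unlock linearB /= derivC subr0.
rewrite derivXn -scaler_nat coprimepZr //= exprS coprimep_sym.
rewrite coprimep_addl_mul -polyCN -[_%:P]mulr1 mul_polyC coprimepZr ?coprimep1 //.
by rewrite oppr_eq0.
Qed.

(** By multiplicativity q^2 | P gives J(q)^2 | J(P), and J(q) is not constant when q is not. *)
Lemma separable_joukowski_squarefree (F : fieldType) d (P : {poly F}) :
  (size P <= d.+1)%N -> separable_poly (joukowski d P) ->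
  forall q, irreducible_poly q -> ~~ (q ^+ 2 %| P).
Proof.
move=> sP sep q irrq; apply/negP => /dvdpP[r DP].
have J0 : joukowski d P != 0 by apply: separable_poly_neq0.
have P0 : P != 0.
  apply: contraNneq J0 => ->; rewrite joukowskiE big1 // => i _.
  by rewrite coef0 scale0r.
have q0 := irredp_neq0 irrq.
have r0 : r != 0 by apply: contraNneq P0 => r0; rewrite DP r0 mul0r.
have [e sq] : exists e, size q = e.+2.
  by exists (size q).-2; have := irrq.1; case: (size q) => [|[]].
have sqq : (size (q ^+ 2) <= (e.+1 * 2).+1)%N.
  by rewrite (leq_trans (size_poly_exp_leq _ _)) // sq.
move: sP; rewrite DP size_mul ?expf_neq0 // expr2 size_mul // sq => sP.
have sr : (size r <= (d - e.+1 * 2).+1)%N by move: sP; move: (size r) => k; lia.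
have ed : d = (d - e.+1 * 2 + e.+1 * 2)%N.
  by move: sP r0; rewrite -size_poly_gt0; move: (size r) => k; lia.
have [sJ _] := size_joukowski q0 (eq_leq sq).
have := @separable_nosquare _ _ (joukowski e.+1 q) 2 sep isT.
rewrite sJ sq addnS addnS => /(_ isT) /negP; apply.
by rewrite DP ed joukowskiM // joukowski_exp ?sq // dvdp_mull.
Qed.

(** Were the order m of [w] a proper divisor of n, [w] would also be a root of Phi_d for some d | m.
    Then Phi_n and Phi_d would be two factors of X^n - 1 with a common root, against its
    separability. *)
Lemma root_Cyclotomic (F : fieldType) n (w : F) :
  n%:R != 0 :> F -> root (map_poly intr 'Phi_n) w -> n.-primitive_root w.
Proof.
move=> nz_n Phi_w.
have n0 : (0 < n)%N by case: n nz_n {Phi_w} => //; rewrite eqxx.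
have prodE k : (0 < k)%N ->
    \prod_(d <- divisors k) map_poly (intr : int -> F) 'Phi_d = 'X^k - 1.
  move=> k0; rewrite -rmorph_prod prod_Cyclotomic //.
  by rewrite rmorphB rmorph1 /= map_polyXn.
have nn : n \in divisors n by rewrite -dvdn_divisors.
have wn : w ^+ n = 1.
  have : root ('X^n - 1) w by rewrite -prodE // (big_rem n) //= rootM Phi_w.
  by rewrite rootE !hornerE subr_eq0 => /eqP.
have [m prim_m mn] := prim_order_exists n0 wn.
have [<- //|neq_mn] := eqVneq m n.
have : root ('X^m - 1) w.
  by rewrite rootE !hornerE (prim_expr_order prim_m) subrr.
rewrite -prodE ?(prim_order_gt0 prim_m) //.
rewrite rootE horner_prod prodf_seq_eq0 => /hasP[d dm /= Phi_d].
have dn : d \in rem n (divisors n).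
  rewrite mem_rem_uniq ?divisors_uniq // inE /= -dvdn_divisors //.
  move: dm; rewrite -dvdn_divisors ?(prim_order_gt0 prim_m) // => dm.
  rewrite (dvdn_trans dm mn) andbT; apply: contra_neq neq_mn => dn.
  by apply/eqP; rewrite eqn_dvd mn -{1}dn.
have := separable_Xn_sub_1 nz_n.
rewrite -prodE // (big_rem n nn) (big_rem d dn) /= mulrA separable_mul.
case/and3P=> + _ _; rewrite separable_mul => /and3P[_ _].
by move/coprimep_root => /(_ _ Phi_w); rewrite Phi_d.
Qed.

Lemma map_twisted_cyclotomic (R : comNzRingType) n :
  map_poly (intr : int -> R) (twisted_cyclotomic n)
    = (-1) ^+ totient n *: (map_poly intr 'Phi_n \Po - 'X^2).
Proof.
rewrite /twisted_cyclotomic map_polyZ /= rmorphXn rmorphN rmorph1.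
by rewrite map_comp_poly /= rmorphN /= map_polyXn.
Qed.

Lemma twisted_cyclotomic_dvdp (F : fieldType) n : (0 < n)%N ->
  map_poly (intr : int -> F) (twisted_cyclotomic n) %| 'X^(2 * n) - ((-1) ^+ n)%:P.
Proof.
move=> n0; have := prod_twisted_cyclotomic n0.
rewrite (big_rem n) -?dvdn_divisors //= => /(congr1 (map_poly (intr : int -> F))).
rewrite rmorphM rmorphB /= map_polyXn rmorphXn rmorphN rmorph1.
by rewrite polyC_exp polyCN => <-; rewrite dvdp_mulIl.
Qed.

Lemma separable_twisted_cyclotomic (F : fieldType) n :
  (2 * n)%:R != 0 :> F ->
  separable_poly (map_poly (intr : int -> F) (twisted_cyclotomic n)).
Proof.
move=> nz; have n0 : (0 < n)%N by case: n nz => //; rewrite muln0 eqxx.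
apply: dvdp_separable (twisted_cyclotomic_dvdp F n0) _.
by rewrite separable_XnsubC ?signr_eq0.
Qed.

Lemma exists_joukowski_preimage (K : closedFieldType) (theta : K) :
  exists t, t ^+ 2 - 1 = theta * t.
Proof.
have /closed_rootP[t] : size ('X^2 - (theta *: 'X + 1)) != 1%N.
  rewrite size_polyDl ?size_polyXn // size_polyN.
  rewrite (leq_ltn_trans (size_polyD _ _)) // size_poly1 gtn_max andbT.
  by rewrite (leq_ltn_trans (size_scale_leq _ _)) // size_polyX.
rewrite rootE !hornerE => /eqP t0; exists t.
by apply/eqP; rewrite -subr_eq0 -t0; apply/eqP; ring.
Qed.

Section JoukowskiRoots.

Variables (K : fieldType) (t theta : K).
Hypothesis tE : t ^+ 2 - 1 = theta * t.

(** Only divisibility of the images is asked for: this absorbs the sign of [twisted_cyclotomic], and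
    in characteristic 2 it admits the square root of the reduced fibotomic polynomial. *)
Lemma joukowski_root_primitive n (S : {poly K}) d :
  n%:R != 0 :> K -> (size S <= d.+1)%N ->
  joukowski d S %| map_poly intr 'Phi_n \Po - 'X^2 ->
  root S theta -> n.-primitive_root (- t ^+ 2).
Proof.
move=> nz sS SPhi Sth; apply: root_Cyclotomic => //.
have : root (map_poly intr 'Phi_n \Po - 'X^2) t.
  have /dvdpP[r ->] := SPhi.
  rewrite rootM; apply/orP; right.
  by rewrite rootE (horner_joukowski sS tE) (rootP Sth) mulr0.
by rewrite rootE horner_comp !hornerE.
Qed.

(** Binet's formula at a zero of F_(k+1); the order of -t^2 must therefore divide every index at
    which the Fibonacci polynomial vanishes at theta. *)
Lemma fibpoly_root k :
  root (map_poly (intr : int -> K) (fibpoly k.+1)) theta -> (- t ^+ 2) ^+ k.+1 = 1.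
Proof.
move=> /rootP Fth; have [sF _] := fibpoly_monic k.
have sF' : (size (map_poly (intr : int -> K) (fibpoly k.+1)) <= k.+1)%N.
  by rewrite (leq_trans (size_poly _ _)) // sF.
have := congr1 (fun P => (map_poly (intr : int -> K) P).[t]) (joukowski_fibpoly k).
rewrite rmorphM /= map_joukowski hornerM (horner_joukowski sF' tE) Fth mulr0 mul0r.
rewrite rmorphB /= map_polyXn rmorphXn rmorphN rmorph1.
rewrite -polyC1 -polyCN -polyC_exp !hornerE.
move/esym/eqP; rewrite subr_eq0 exprM => /eqP tk.
by rewrite exprNn tk -exprMn mulrNN mulr1 expr1n.
Qed.

End JoukowskiRoots.

Lemma dvdp_fibotomic_sol (F : fieldType) n S :
  fibotomic_sol n S ->
  joukowski (totient n) (map_poly (intr : int -> F) S) %|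
    map_poly intr 'Phi_n \Po - 'X^2.
Proof.
case=> mS sS JS; rewrite -map_joukowski JS map_twisted_cyclotomic.
by rewrite dvdpZl ?signr_eq0.
Qed.

Lemma size_map_fibotomic_sol (R : nzRingType) n S :
  fibotomic_sol n S -> size (map_poly (intr : int -> R) S) = (totient n).+1.
Proof.
by case=> mS sS _; rewrite size_poly_eq // -lead_coefE (monicP mS) oner_eq0.
Qed.

Section FibotomicRational.

Variables (n : nat) (S : nat -> {poly int}).
Hypothesis SP : forall d, (1 < d <= n)%N -> fibotomic_sol d (S d).
Hypothesis n_gt1 : (1 < n)%N.

Lemma fibotomic_sol_dvd_fibpoly N : (1 < N <= n)%N ->
  polyQ (S N) %| polyQ (fibpoly N).
Proof.
case: N => // N /andP[N1 Nn]; rewrite (fibpoly_prod SP) //.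
rewrite (@bigD1_seq_cond _ _ _ _ _ _ N.+1) ?divisors_uniq -?dvdn_divisors //.
  by rewrite /polyQ rmorphM dvdp_mulIl.
by rewrite gtn_eqF.
Qed.

(** A complex root theta of a factor [q] of [S n] comes from a primitive n-th root of unity -t^2, so
    q | F_k forces n | k, impossible for 0 < k < n. Conversely a factor of F_n divides some [S d]
    with d | n, hence F_d, and newness leaves only d = n. *)
Lemma irreducible_dvd_fibotomic_sol (q : {poly rat}) : irreducible_poly q ->
  (q %| polyQ (S n)) =
    (q %| polyQ (fibpoly n)) &&
    [forall k : 'I_n, (0 < k)%N ==> ~~ (q %| polyQ (fibpoly k))].
Proof.
move=> irrq; have Sn : fibotomic_sol n (S n) by apply: SP; rewrite n_gt1 /=.
apply/idP/andP => [qS|[qF /forallP nqF]].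
  have nn : (1 < n <= n)%N by rewrite n_gt1 /=.
  split; first exact: dvdp_trans qS (fibotomic_sol_dvd_fibpoly nn).
  apply/forallP => -[[//|k] kn]; apply/implyP => /= _; apply/negP => qF.
  have /closed_rootP[theta qth] : size (map_poly (ratr : rat -> algC) q) != 1%N.
    by rewrite size_map_poly gtn_eqF // irrq.1.
  have [t tE] := exists_joukowski_preimage theta.
  have rootZ (P : {poly int}) : q %| polyQ P ->
      root (map_poly (intr : int -> algC) P) theta.
    rewrite -(dvdp_map (ratr : {rmorphism rat -> algC})) -map_poly_comp.
    rewrite [X in _ %| X](@eq_map_poly _ _ _ intr) => [qP|a]; last first.
      by rewrite /= rmorph_int.
    by move: qth; rewrite -!dvdp_XsubCl => /dvdp_trans; apply.
  have prim : n.-primitive_root (- t ^+ 2).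
    apply: (joukowski_root_primitive tE _ _ (dvdp_fibotomic_sol _ Sn) (rootZ _ qS)).
      by rewrite pnatr_eq0 -lt0n ltnW.
    by rewrite (size_map_fibotomic_sol _ Sn).
  have := fibpoly_root tE (rootZ _ qF) => /eqP.
  rewrite -(prim_order_dvd prim) => /dvdn_leq => /(_ isT).
  by rewrite leqNgt kn.
have n0 : n = n.-1.+1 by rewrite prednK // ltnW.
move: qF; rewrite {1}n0 (fibpoly_prod SP) -?n0 // /polyQ rmorph_prod.
case/(irreducible_dvdp_prod irrq) => d [dn d1 qd].
have d0 : (0 < d)%N.
  by move: dn; rewrite -dvdn_divisors ?(ltnW n_gt1) //; apply: dvdn_gt0; exact: ltnW.
have dle : (d <= n)%N.
  by move: dn; rewrite -dvdn_divisors ?(ltnW n_gt1) //; apply: dvdn_leq; exact: ltnW.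
have [<- //|neq_dn] := eqVneq d n.
have ltdn : (d < n)%N by rewrite ltn_neqAle neq_dn.
have := nqF (Ordinal ltdn); rewrite /= d0 /= => /negP[].
apply: dvdp_trans qd (fibotomic_sol_dvd_fibpoly _).
by rewrite dle andbT ltn_neqAle eq_sym d1.
Qed.

Lemma is_fibotomic_sol Psi : is_fibotomic n Psi -> Psi = S n.
Proof.
rewrite /is_fibotomic leqNgt n_gt1 /= => -[mPsi sqf irrPsi].
have Sn : fibotomic_sol n (S n) by apply: SP; rewrite n_gt1 /=.
have [mS sS JS] := Sn.
have mQ (P : {poly int}) : P \is monic -> polyQ P \is monic.
  move=> mP; rewrite monicE lead_coef_map_inj ?(monicP mP) //.
  exact: intr_inj.
apply: (map_inj_poly (intr_inj : injective (intr : int -> rat))) => //.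
apply/eqP; rewrite -eqp_monic ?mQ //; apply/andP; split.
  apply: squarefree_dvdp => [|q mq irrq qP]; first exact: mQ.
  by split; [exact: sqf|rewrite irreducible_dvd_fibotomic_sol // -irrPsi].
apply: squarefree_dvdp => [|q mq irrq qP]; first exact: mQ.
split; last by rewrite irrPsi // -irreducible_dvd_fibotomic_sol.
apply: (separable_joukowski_squarefree (d := totient n)) => //.
  by rewrite (size_map_fibotomic_sol _ Sn).
rewrite -map_joukowski JS separable_twisted_cyclotomic // pnatr_eq0.
by rewrite muln_eq0 /= -lt0n ltnW.
Qed.

End FibotomicRational.

(** * Cyclotomic polynomials modulo p *)

Lemma pchar_polyFp p : prime p -> p \in [pchar {poly 'F_p}].
Proof. by move=> p_pr; rewrite (rmorph_pchar polyC) ?pchar_Fp. Qed.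

(** The divisors are sorted by their p-adic valuation: at most j, or exactly j + 1. *)
Lemma perm_divisors_pfactor p j m : prime p -> (0 < m)%N -> coprime p m ->
  perm_eq (divisors (p ^ j.+1 * m))
    (divisors (p ^ j * m) ++ [seq (p ^ j.+1 * d)%N | d <- divisors m]).
Proof.
move=> p_pr m0 co_pm; have p0 := prime_gt0 p_pr.
have pm0 i : (0 < p ^ i * m)%N by rewrite muln_gt0 expn_gt0 p0.
apply: uniq_perm; first exact: divisors_uniq.
  rewrite cat_uniq divisors_uniq /= map_inj_uniq ?divisors_uniq ?andbT; last first.
    by move=> a b /eqP; rewrite eqn_pmul2l ?expn_gt0 ?p0 // => /eqP.
  apply/hasPn => _ /mapP[d _ ->]; rewrite -dvdn_divisors //.
  apply/negP => dd; move: co_pm; rewrite prime_coprime // => /negP; apply.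
  rewrite -(@dvdn_pmul2l (p ^ j)) ?expn_gt0 ?p0 // -expnSr.
  exact: dvdn_trans (dvdn_mulr d (dvdnn _)) dd.
move=> d; rewrite mem_cat -!dvdn_divisors //.
apply/idP/orP => [dd|[dd|/mapP[e]]]; last first.
- by rewrite -dvdn_divisors // => em ->; rewrite dvdn_pmul2l ?expn_gt0 ?p0.
- by rewrite (dvdn_trans dd) // dvdn_mul // dvdn_exp2l.
have d0 : (0 < d)%N by apply: dvdn_gt0 dd.
have [e co_pe De] := pfactor_coprime p_pr d0.
have em : (e %| m)%N.
  have : (e %| p ^ j.+1 * m)%N by apply: dvdn_trans dd; rewrite De dvdn_mulr.
  by rewrite Gauss_dvdr // coprime_sym coprimeXl.
have [aj|ja] := leqP (logn p d) j.
  by left; rewrite De mulnC dvdn_mul // dvdn_exp2l.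
right; apply/mapP; exists e; rewrite -?dvdn_divisors // {1}De mulnC.
congr (p ^ _ * _)%N; apply/eqP; rewrite eqn_leq ja andbT.
have : (p ^ logn p d %| p ^ j.+1 * m)%N.
  by apply: dvdn_trans dd; rewrite {2}De dvdn_mull.
rewrite Gauss_dvdl ?coprimeXl // => /(dvdn_leq _); rewrite expn_gt0 p0 => /(_ isT).
by rewrite leq_exp2l ?prime_gt1.
Qed.

Lemma prod_twisted_cyclotomic_map (R : comNzRingType) n : (0 < n)%N ->
  \prod_(d <- divisors n) map_poly (intr : int -> R) (twisted_cyclotomic d)
    = 'X^(2 * n) - (-1) ^+ n.
Proof.
move=> n0; rewrite -rmorph_prod prod_twisted_cyclotomic // rmorphB /=.
by rewrite map_polyXn rmorphXn rmorphN rmorph1.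
Qed.

(** Both sides are binomials t^(2n) - (-1)^n, and the Frobenius raises such a binomial to the power
    p^k termwise. *)
Lemma prod_twisted_cyclotomic_pfactor p k m : prime p -> (0 < m)%N ->
  \prod_(d <- divisors (p ^ k * m))
     map_poly (intr : int -> 'F_p) (twisted_cyclotomic d)
  = (\prod_(d <- divisors m)
     map_poly (intr : int -> 'F_p) (twisted_cyclotomic d)) ^+ (p ^ k).
Proof.
move=> p_pr m0; rewrite !prod_twisted_cyclotomic_map //; last first.
  by rewrite muln_gt0 expn_gt0 prime_gt0.
have pnat_pk : [pchar {poly 'F_p}].-nat (p ^ k)%N.
  by rewrite (eq_pnat _ (pcharf_eq (pchar_polyFp p_pr))) pnatX pnat_id.
rewrite exprDn_pchar // [(- (-1) ^+ m) ^+ _]exprNn_pchar //.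
rewrite mulnCA [(p ^ k * m)%N]mulnC [(p ^ k * (2 * m))%N]mulnC.
by rewrite !exprM.
Qed.

(** The divisor products for p^(k+1) n and p^k n are the p^(k+1)-th and p^k-th powers of the one for
    n, so the divisors of exact valuation k + 1 account for the exponent p^(k+1) - p^k, the totient
    ([powE]). Induction on m cancels the proper divisors of m. *)
Lemma twisted_cyclotomic_pfactor p k m : prime p -> (0 < m)%N -> coprime p m ->
  map_poly (intr : int -> 'F_p) (twisted_cyclotomic (p ^ k * m))
    = map_poly intr (twisted_cyclotomic m) ^+ totient (p ^ k).
Proof.
case: k => [|k] p_pr; first by rewrite mul1n expr1.
pose C d := map_poly (intr : int -> 'F_p) (twisted_cyclotomic d).
have C0 d : (0 < d)%N -> C d != 0.
  move=> d0; apply: dvdpN0 (twisted_cyclotomic_dvdp _ d0) _.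
  by rewrite -size_poly_eq0 size_XnsubC // muln_gt0.
have prodC0 n r : (0 < n)%N -> {subset r <= divisors n} -> \prod_(d <- r) C d != 0.
  move=> n0 rn; rewrite prodf_seq_neq0; apply/allP => d /rn.
  by rewrite -dvdn_divisors // => dn; apply/implyP => _; apply/C0/(dvdn_gt0 n0 dn).
have powE n : (0 < n)%N -> coprime p n ->
  \prod_(d <- divisors n) C (p ^ k.+1 * d)%N
    = (\prod_(d <- divisors n) C d) ^+ totient (p ^ k.+1).
  move=> n0 co_pn; have := prod_twisted_cyclotomic_pfactor k.+1 p_pr n0.
  rewrite (perm_big _ (perm_divisors_pfactor k p_pr n0 co_pn)) big_cat big_map /=.
  have totE : (p ^ k + totient (p ^ k.+1) = p ^ k.+1)%N.
    by rewrite totient_pfactor //= -mulSn prednK ?prime_gt0 // expnS.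
  rewrite prod_twisted_cyclotomic_pfactor // => prodE.
  have nz : (\prod_(d <- divisors n) C d) ^+ (p ^ k) != 0.
    by rewrite expf_neq0 // (prodC0 n).
  by apply: (mulfI nz); rewrite -exprD totE.
elim/ltn_ind: m => m IHm m0 co_pm.
rewrite -/(C (p ^ k.+1 * m)%N) -/(C m); have := powE m m0 co_pm.
have mm : m \in divisors m by rewrite -dvdn_divisors.
rewrite !(big_rem m mm) /= exprMn.
have -> : \prod_(d <- rem m (divisors m)) C (p ^ k.+1 * d)%N =
   (\prod_(d <- rem m (divisors m)) C d) ^+ totient (p ^ k.+1).
  rewrite -prodrXl; apply: eq_big_seq => d.
  rewrite mem_rem_uniq ?divisors_uniq // inE /= -dvdn_divisors // => /andP[dm' dm].
  have ltdm : (d < m)%N by rewrite ltn_neqAle dm' dvdn_leq.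
  exact: IHm ltdm (dvdn_gt0 m0 dm) (coprime_dvdr dm co_pm).
apply: mulIf; rewrite expf_neq0 //; apply: (prodC0 m) => // d.
exact: mem_rem.
Qed.

(** * Degrees of irreducible factors over F_p *)

(** An irreducible [q] either divides [P] or is coprime to it, and coprimality persists in the
    extension; a single root of [q] thus decides. *)
Lemma irreducible_dvdp_root (F L : fieldType) (f : {rmorphism F -> L})
    (q P : {poly F}) (z : L) :
  irreducible_poly q -> root (map_poly f q) z ->
  (q %| P) = root (map_poly f P) z.
Proof.
move=> irrq qz; apply/idP/idP => [|Pz].
  by rewrite -(dvdp_map f) => /dvdpP[r ->]; rewrite rootM qz orbT.
apply: contraLR Pz; rewrite -irreducible_poly_coprime // -(coprimep_map f).
by move/coprimep_root; apply.
Qed.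

Lemma expFp_pfactor p e (c : 'F_p) : prime p -> c ^+ (p ^ e) = c.
Proof.
move=> p_pr; elim: e => [|e IHe]; first by rewrite expr1.
by rewrite expnS exprM -[X in c ^+ X](card_Fp p_pr) expf_card.
Qed.

Lemma map_XexpBX (F L : fieldType) (f : {rmorphism F -> L}) n z :
  root (map_poly f ('X^n - 'X)) z = (z ^+ n == z).
Proof. by rewrite rmorphB /= map_polyXn map_polyX rootE !hornerE subr_eq0. Qed.

(** Let z generate the field F_p[x]/(q), of cardinality p^(deg q). If z is fixed by the e-th power
    of the Frobenius, so is every polynomial in z, hence the whole field; it then consists of roots
    of X^(p^e) - X, which is nonzero for e > 0, so deg q <= e. *)
Lemma irreducible_dvdp_XexpBX p (q : {poly 'F_p}) : prime p -> irreducible_poly q ->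
  q %| 'X^(p ^ (size q).-1) - 'X /\
  forall e, (0 < e)%N -> q %| 'X^(p ^ e) - 'X -> ((size q).-1 <= e)%N.
Proof.
move=> p_pr irrq; have [L dimL [z qz genz]] := irredp_FAdjoin irrq.
have dvdE n : (q %| 'X^n - 'X) = (z ^+ n == z).
  by rewrite (irreducible_dvdp_root _ irrq qz) (map_XexpBX (in_alg L)).
split=> [|e e0]; rewrite dvdE.
  have := Fermat's_little_theorem {:L}%AS z.
  by rewrite memvf dimL card_Fp // => <-.
move/eqP => ze.
have pcharL : p \in [pchar L] by rewrite (rmorph_pchar (in_alg L)) ?pchar_Fp.
have pnat_pe : [pchar L].-nat (p ^ e)%N.
  by rewrite (eq_pnat _ (pcharf_eq pcharL)) pnatX pnat_id.
have fixL (y : L) : y ^+ (p ^ e) = y.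
  have : y \in <<1; z>>%VS by rewrite genz memvf.
  move/Fadjoin_poly_eq <-; have /polyOver1P[g ->] := Fadjoin_polyOver 1%VS z y.
  elim/poly_ind: g => [|g c IHg].
    by rewrite rmorph0 horner0 expr0n expn_eq0 -leqn0 leqNgt prime_gt0.
  rewrite rmorphD rmorphM /= map_polyX map_polyC hornerMXaddC.
  rewrite exprDn_pchar // exprMn IHg ze; congr (_ + _).
  by rewrite -rmorphXn /= expFp_pfactor.
pose K := finvect_type L.
have cardK : #|K| = (p ^ (size q).-1)%N.
  have := @card_vspace _ K _ {: K}%VS.
  rewrite card_Fp // [\dim _]dimL => <-.
  by apply: eq_card => y; rewrite [RHS]memvf.
rewrite -(leq_exp2l _ _ (prime_gt1 p_pr)) -cardK cardE.
have szX : size ('X^(p ^ e) - 'X : {poly L}) = (p ^ e).+1.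
  rewrite size_polyDl ?size_polyXn // size_polyN size_polyX ltnS.
  by have := ltn_exp2l 0 e (prime_gt1 p_pr); rewrite expn0 e0.
rewrite -ltnS -szX; apply: (@max_poly_roots L _ (enum K)) => //.
- by rewrite -size_poly_eq0 szX.
- by apply/allP => y _; rewrite rootE !hornerE fixL subrr.
- exact: enum_uniq.
Qed.

(** * Arithmetic of delta *)

Lemma head_filter_iota (P : pred nat) i n : has P (iota i n) ->
  let h := nth 0%N [seq u <- iota i n | P u] 0 in
  [/\ P h, (i <= h)%N & forall j, (i <= j < h)%N -> ~~ P j].
Proof.
elim: n i => //= n IHn i; case: (boolP (P i)) => [Pi _|nPi /= /IHn[Ph ih minh]].
  by split=> // j; case: ltngtP.
split=> [||j /andP[ij jh]] //; first exact: ltnW.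
by move: ij; rewrite leq_eqVlt => /predU1P[<- //|ij]; rewrite minh ?ij.
Qed.

Lemma ordmodP a N : (0 < N)%N -> coprime a N ->
  (0 < ordmod a N)%N /\
  forall e, (a ^ e == 1 %[mod N]) = (ordmod a N %| e)%N.
Proof.
move=> N0 co_aN; have : has (fun u => a ^ u == 1 %[mod N]) (iota 1 N).
  (* Euler's theorem provides an exponent, and [totient N] lies in the range 1..N searched by
     [ordmod]. *)
  apply/hasP; exists (totient N); last by rewrite Euler_exp_totient.
  rewrite mem_iota totient_gt0 N0 add1n ltnS totient_count_coprime.
  rewrite -[X in (_ <= X)%N](subn0 N) -[X in (_ <= X)%N]muln1 -sum_nat_const_nat.
  by apply: leq_sum => i _; apply: leq_b1.
move/head_filter_iota; rewrite -/(ordmod a N); set u := ordmod a N.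
case=> /eqP au u0 minu; split=> // e.
have red : a ^ e = a ^ (e %% u) %[mod N].
  rewrite {1}(divn_eq e u) expnD [(_ * u)%N]mulnC expnM.
  by rewrite -modnMml -modnXm au modnXm exp1n modnMml mul1n.
rewrite red /dvdn; apply/idP/idP => [au1|/eqP ->]; last by rewrite expn0.
rewrite -leqn0 leqNgt; apply/negP => r0.
by have := minu (e %% u)%N; rewrite r0 ltn_pmod // => /(_ isT); rewrite au1.
Qed.

Lemma eqn_mod_dvdB1 (Q N : nat) : (0 < Q)%N -> (Q == 1 %[mod N])%N = (N %| Q - 1)%N.
Proof. by move=> Q0; rewrite eqn_mod_dvd. Qed.

Lemma modn_predN (Q N : nat) : (1 < N)%N -> (Q %% N == N.-1)%N = (N %| Q + 1)%N.
Proof.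
move=> N1; apply/eqP/idP => [h|/dvdnP[c Dc]].
  by rewrite (divn_eq Q N) h -addnA addn1 prednK ?(ltnW N1) // dvdn_addl ?dvdn_mull.
have -> : Q = (c.-1 * N + N.-1)%N by case: c Dc => [|c]; rewrite ?mulSn; lia.
by rewrite modnMDl modn_small // ltn_predL ltnW.
Qed.

(** Leaves one candidate below [u]: the only odd multiple of u/2 smaller than u is u/2 itself. *)
Lemma half_dvd_cases (u e : nat) : (0 < e)%N -> (u %| 2 * e)%N -> ~~ (u %| e)%N ->
  exists c, [/\ ~~ odd u, odd c & e = (u %/ 2 * c)%N].
Proof.
move=> e0 /dvdnP[c Dc] nue.
have oc : odd c.
  apply: contraT => ec; case/negP: nue; apply/dvdnP; exists c./2.
  by move: Dc; rewrite -{1}(even_halfK ec); lia.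
have eu : ~~ odd u.
  by have := congr1 odd Dc; rewrite oddM /= oddM oc /= => <-.
by exists c; split=> //; move: Dc; rewrite -{1}(even_halfK eu) divn2; lia.
Qed.

Lemma pow_mod4 (p e : nat) : odd p -> (p ^ e %% 4 = if odd e then p %% 4 else 1)%N.
Proof.
move=> op; rewrite -modnXm; have : ((p %% 4 == 1) || (p %% 4 == 3))%N.
  have := modn_mod p 4; have := ltn_pmod p (isT : 0 < 4)%N.
  have : odd (p %% 4)%N by rewrite odd_mod.
  by case: (p %% 4)%N => [|[|[|[|]]]].
case/orP => /eqP ->; first by rewrite exp1n if_same.
elim: e => // e IHe; rewrite expnS -modnMmr IHe /=; by case: (odd e).
Qed.

(* For odd Q, [2m | Q -+ 1] and [m | Q -+ 1, 2m not dividing Q -+ 1] say that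
   w^((Q -+ 1)/2) equals 1, resp. -1, when w is a primitive m-th root of unity. *)
Definition frobenius_fixed p m e :=
  let Q := (p ^ e)%N in
  if (Q %% 4 == 1)%N then (2 * m %| Q - 1)%N || (2 * m %| Q + 1)%N
  else ((m %| Q - 1)%N && ~~ (2 * m %| Q - 1)%N)
    || ((m %| Q + 1)%N && ~~ (2 * m %| Q + 1)%N).

Lemma odd_mulP (m Q : nat) :
  (m %| Q)%N && ~~ (2 * m %| Q)%N -> exists k, Q = (2 * m * k + m)%N.
Proof.
case/andP => /dvdnP[c Dc] nd; exists c./2.
have oc : odd c.
  apply: contraT => ec; case/negP: nd; apply/dvdnP; exists c./2.
  by move: Dc; rewrite -{1}(even_halfK ec); lia.
by move: Dc; rewrite -{1}(odd_double_half c) oc; lia.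
Qed.

Lemma odd_mul_dvdn (m k : nat) : (0 < m)%N ->
  (m %| 2 * m * k + m)%N && ~~ (2 * m %| 2 * m * k + m)%N.
Proof.
move=> m0; have d2 : (2 * m %| 2 * m * k)%N by rewrite dvdn_mulr.
rewrite dvdn_addl ?dvdnn // (dvdn_trans _ d2) ?dvdn_mull //=.
by rewrite dvdn_addr // gtnNdvd // ltn_Pmull.
Qed.

(** Passage to the residues that occur in [delta_odd]: Q - 1 is an odd multiple of m exactly when Q
    = m + 1 modulo 2m, and Q + 1 is one exactly when Q = m - 1. *)
Lemma frobenius_fixed_modn (p m e : nat) : odd p -> (2 < m)%N ->
  frobenius_fixed p m e =
  (let h := (p ^ e %% (2 * m))%N in
   if (p ^ e %% 4 == 1)%N then (h == 1)%N || (h == (2 * m).-1)%N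
   else (h == m.+1) || (h == m.-1)).
Proof.
move=> op m2; have Q0 : (0 < p ^ e)%N by rewrite expn_gt0; case: p op.
have m0 : (1 < 2 * m)%N by lia.
rewrite /frobenius_fixed /=; case: ifP => _.
  by rewrite modn_predN // -eqn_mod_dvdB1 // [(1 %% _)%N]modn_small.
congr (_ || _); apply/idP/eqP.
- move/odd_mulP => [k Dk].
  have -> : (p ^ e = k * (2 * m) + m.+1)%N by lia.
  by rewrite modnMDl modn_small //; lia.
- move=> h; have -> : (p ^ e - 1 = (p ^ e %/ (2 * m)) * (2 * m) + m)%N.
    by have := divn_eq (p ^ e) (2 * m); rewrite h; lia.
  by rewrite mulnC odd_mul_dvdn // ltnW // ltnW.
- move/odd_mulP => [k Dk].
  have -> : (p ^ e = k * (2 * m) + m.-1)%N by lia.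
  by rewrite modnMDl modn_small //; lia.
- move=> h; have -> : (p ^ e + 1 = (p ^ e %/ (2 * m)) * (2 * m) + m)%N.
    by have := divn_eq (p ^ e) (2 * m); rewrite h; lia.
  by rewrite mulnC odd_mul_dvdn // ltnW // ltnW.
Qed.

(** A solution e satisfies u | 2e, so it is a multiple of u or an odd multiple of u/2. The first
    branch of [delta_odd] says that u/2 is a solution. Otherwise u is the least one, except when p =
    3 modulo 4 and u is odd: no odd multiple of u is then a solution, and 2u is the least. *)
Lemma delta_odd_min (p m : nat) : odd p -> (2 < m)%N -> coprime p m ->
  [/\ (0 < delta_odd p m)%N, frobenius_fixed p m (delta_odd p m) &
      forall e, (0 < e)%N -> frobenius_fixed p m e -> (delta_odd p m <= e)%N].
Proof.
move=> op m2 co_pm.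
have m0 : (1 < 2 * m)%N by lia.
have [|u0 uP] := @ordmodP p (2 * m) (ltnW m0); first by rewrite coprimeMr coprimen2 op.
pose Q e := (p ^ e)%N.
have Q0 e : (0 < Q e)%N by rewrite expn_gt0; case: p op {co_pm uP u0 Q}.
have u2e e : frobenius_fixed p m e -> (ordmod p (2 * m) %| 2 * e)%N.
  move=> fe; rewrite -uP eqn_mod_dvdB1 ?(Q0 (2 * e)%N) // [(2 * e)%N]mulnC expnM -/(Q e).
  have -> : (Q e ^ 2 - 1 = (Q e - 1) * (Q e + 1))%N by rewrite -[1%N]/(1 ^ 2)%N subn_sqr.
  (* Q - 1 and Q + 1 are both even: when one of them is only known to be divisible by m, the other
     supplies the factor 2. *)
  have oQ : odd (Q e) by rewrite oddX op orbT.
  have d1 : (2 %| Q e - 1)%N by rewrite dvdn2 oddB // oQ.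
  have d2 : (2 %| Q e + 1)%N by rewrite dvdn2 oddD oQ.
  move: fe; rewrite /frobenius_fixed -/(Q e); case: ifP => _ /orP[].
  - exact: dvdn_mulr.
  - exact: dvdn_mull.
  - by case/andP => mQ _; rewrite mulnC dvdn_mul.
  - by case/andP => mQ _; rewrite dvdn_mul.
have p4 : ((p %% 4 == 1) || (p %% 4 == 3))%N.
  have := ltn_pmod p (isT : 0 < 4)%N.
  have : odd (p %% 4)%N by rewrite odd_mod.
  by case: (p %% 4)%N => [|[|[|[|]]]].
have u2d e : ~~ (ordmod p (2 * m) %| e)%N -> (p ^ e %% (2 * m) == 1)%N = false.
  rewrite -uP => /negPf; rewrite [(1 %% _)%N]modn_small //.
rewrite /delta_odd; set u := ordmod p (2 * m) in u0 uP u2e u2d *.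
have fE e := frobenius_fixed_modn e op m2.
have leu2 e : ~~ odd u -> (0 < e)%N -> (u %| 2 * e)%N -> (u %/ 2 <= e)%N.
  move=> eu e0 /(dvdn_leq _); rewrite muln_gt0 e0 => /(_ isT).
  by rewrite -{1}(even_halfK eu) divn2; lia.
have u4 : ((u %% 4 == 0) || (u %% 4 == 2))%N = ~~ odd u.
  have := ltn_pmod u (isT : 0 < 4)%N; have := @odd_mod u 4 erefl.
  by case: (u %% 4)%N => [|[|[|[|]]]] // <-.
have ou2 : (u %% 4 == 0)%N -> odd (u %/ 2) = false.
  by move=> /eqP u40; rewrite divn2; have := divn_eq u 4; rewrite u40; lia.
have ou2' : (u %% 4 == 2)%N -> odd (u %/ 2) = true.
  by move=> /eqP u42; rewrite divn2; have := divn_eq u 4; rewrite u42; lia.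
have u20 : ~~ odd u -> (0 < u %/ 2)%N by move=> eu; lia.
case: ifP => [C|nC].
  have eu : ~~ odd u.
    by case/or3P: C => /and3P[_ C _]; rewrite // -u4 C ?orbT.
  split; [exact: u20| |by move=> e e0 /u2e; exact: leu2].
  rewrite fE /= pow_mod4 //.
  case/or3P: C => /and3P[/eqP -> C2 C3].
  - by rewrite if_same /= C3 orbT.
  - by rewrite ou2 //= C3 orbT.
  - by rewrite ou2'.
have fu e : (u %| e)%N -> (p %% 4 == 1)%N || ~~ odd e -> frobenius_fixed p m e.
  rewrite -uP [(1 %% _)%N]modn_small // => ue oe; rewrite fE /= pow_mod4 // ue /=.
  by case/orP: oe => [/eqP ->|/negPf ->]; rewrite ?if_same.
(* Here Q = 3 modulo 4 and Q = 1 modulo 2m, so 1 would have to equal m + 1 or m - 1, impossible for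
   m > 2. *)
have neg2 e : odd e -> (p %% 4)%N = 3%N -> (u %| e)%N -> ~~ frobenius_fixed p m e.
  move=> oe p43; rewrite -uP [(1 %% _)%N]modn_small // => /eqP ue.
  by rewrite fE /= pow_mod4 // oe p43 ue /=; case: (m) m2 => [|[|[|k]]].
case: ifP => [/andP[/eqP p43 ou]|nC2].
  split; first by rewrite muln_gt0.
    by apply: fu; rewrite ?dvdn_mull // oddM orbT.
  move=> e e0 fe; have := u2e e fe.
  rewrite Gauss_dvdr ?coprimen2 // => ue.
  have ee : ~~ odd e by apply: contraL fe => oe; apply: neg2.
  by rewrite dvdn_leq // Gauss_dvd ?coprime2n // dvdn2 ee.
split=> //.
  apply: fu => //; move: nC2; case/orP: p4 => /eqP -> //=.
  by move=> ->.
move=> e e0 fe; rewrite leqNgt; apply/negP => eu.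
have nue : ~~ (u %| e)%N by apply: contraL eu => /(dvdn_leq e0); rewrite leqNgt.
have [c [euu oc De]] := half_dvd_cases e0 (u2e e fe) nue.
have Du : e = (u %/ 2)%N.
  have Du2 : u = (u %/ 2 * 2)%N by rewrite divnK // dvdn2.
  case: c oc De => [|[|c]] //= _ De; first by rewrite De muln1.
  by move: eu; rewrite De [X in (_ < X)%N]Du2 ltn_pmul2l ?u20.
move: fe; rewrite fE /= pow_mod4 // (u2d e nue) /= Du.
move: nC; rewrite euu /=.
case/orP: p4 => /eqP -> /=; first by rewrite if_same orbF => ->.
move: u4; rewrite euu; case/orP => u4.
  by rewrite (ou2 u4) (eqP u4) /= orbF => ->.
by rewrite (ou2' u4) (eqP u4) /= => ->.
Qed.

Lemma delta_two_min (m : nat) : (2 < m)%N -> odd m ->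
  [/\ (0 < delta_two m)%N,
      (m %| 2 ^ delta_two m - 1)%N || (m %| 2 ^ delta_two m + 1)%N &
      forall e, (0 < e)%N -> (m %| 2 ^ e - 1)%N || (m %| 2 ^ e + 1)%N ->
        (delta_two m <= e)%N].
Proof.
move=> m2 om; have m1 : (1 < m)%N := ltnW m2.
have [||u0 uP] := @ordmodP 2 m; rewrite ?coprime2n // ?(ltnW m1) //.
have uP' e : (ordmod 2 m %| e)%N = (m %| 2 ^ e - 1)%N.
  by rewrite -uP eqn_mod_dvdB1 // expn_gt0.
rewrite /delta_two; set u := ordmod 2 m in u0 uP uP' *.
have u2e e : (m %| 2 ^ e - 1)%N || (m %| 2 ^ e + 1)%N -> (u %| 2 * e)%N.
  rewrite uP' mulnC expnM.
  have -> : ((2 ^ e) ^ 2 - 1 = (2 ^ e - 1) * (2 ^ e + 1))%N.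
    by rewrite -[1%N]/(1 ^ 2)%N subn_sqr.
  by case/orP; [apply: dvdn_mulr|apply: dvdn_mull].
case: ifP => [/andP[eu]|nC].
  have Du2 : u = (u %/ 2 * 2)%N by rewrite divnK // dvdn2.
  rewrite modn_predN // => C; split; last 2 first.
  - by rewrite C orbT.
  - move=> e e0 /u2e /(dvdn_leq _); rewrite muln_gt0 e0 => /(_ isT).
    by rewrite [X in (X <= _)%N]Du2 mulnC leq_pmul2l.
  by rewrite -(@ltn_pmul2r 2) // mul0n -Du2.
split; rewrite -?uP' ?dvdnn // => e e0 fe; rewrite leqNgt; apply/negP => eu.
have nue : ~~ (u %| e)%N by apply: contraL eu => /(dvdn_leq e0); rewrite leqNgt.
have [c [euu oc De]] := half_dvd_cases e0 (u2e e fe) nue.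
have Du2 : u = (u %/ 2 * 2)%N by rewrite divnK // dvdn2.
have u20 : (0 < u %/ 2)%N by rewrite -(@ltn_pmul2r 2) // mul0n -Du2.
have Du : e = (u %/ 2)%N.
  case: c oc De => [|[|c]] //= _ De; first by rewrite De muln1.
  by move: eu; rewrite De [X in (_ < X)%N]Du2 ltn_pmul2l.
move: nC fe; rewrite euu /= modn_predN // -Du => ->.
by rewrite -uP' (negPf nue).
Qed.

(** * Frobenius orbits and factorization modulo p *)

Section FrobeniusFixed.

Variables (K : fieldType) (p : nat) (t theta : K).
Hypotheses (pcharK : p \in [pchar K]) (tE : t ^+ 2 - 1 = theta * t).

Lemma joukowski_neq0 : t != 0.
Proof.
apply: contra_eq_neq tE => ->; rewrite mulr0 expr0n sub0r.
by rewrite oppr_eq0 oner_eq0.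
Qed.

(** With Q = p^e, s = t^Q lies over theta^Q, while the points over theta are t and -1/t. So theta^Q
    = theta exactly when s = t or s t = -1, as the factorization [D] expresses. *)
Lemma frobenius_fixed_joukowski e :
  (theta ^+ (p ^ e) == theta) =
  (t ^+ (p ^ e - 1) == 1) || (t ^+ (p ^ e + 1) == -1).
Proof.
have t0 := joukowski_neq0; set Q := (p ^ e)%N.
have Q0 : (0 < Q)%N by rewrite expn_gt0 prime_gt0 // (pcharf_prime pcharK).
have pnatQ : [pchar K].-nat Q.
  by rewrite (eq_pnat _ (pcharf_eq pcharK)) pnatX pnat_id ?(pcharf_prime pcharK).
set s := t ^+ Q; have s0 : s != 0 by rewrite expf_neq0.
have sE : s ^+ 2 - 1 = theta ^+ Q * s.
  rewrite -exprMn -tE exprDn_pchar // exprNn_pchar // expr1n.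
  by rewrite -!exprM mulnC.
have D : (theta ^+ Q - theta) * (s * t) = (s - t) * (s * t + 1).
  have -> : (theta ^+ Q - theta) * (s * t)
      = (theta ^+ Q * s) * t - (theta * t) * s by ring.
  by rewrite -sE -tE; ring.
rewrite -subr_eq0 -(mulIr_eq0 _ (mulIf (mulf_neq0 s0 t0))) D mulf_eq0 subr_eq0 addr_eq0.
congr (_ || _); last by rewrite exprD expr1.
by rewrite -[RHS](inj_eq (mulIf t0)) mul1r -exprSr subn1 prednK.
Qed.

Lemma prim_root_expN1 m (w : K) a : p != 2%N -> m.-primitive_root w ->
  (w ^+ a == -1) = (m %| 2 * a)%N && ~~ (m %| a)%N.
Proof.
move=> p2 prim; rewrite !(prim_order_dvd prim) mulnC exprM sqrf_eq1.
case: (w ^+ a =P -1) => [->|_]; last by rewrite orbF andbN.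
rewrite orbT /= eq_sym -subr_eq0 opprK -mulr2n -(dvdn_pcharf pcharK).
by rewrite dvdn_prime2 ?(pcharf_prime pcharK) // (negPf p2).
Qed.

(** Write Q = 2r + 1 and w = -t^2. Then t^(Q-1) = (-1)^r w^r and t^(Q+1) = (-1)^(r+1) w^(r+1); the
    parity of r, that is Q modulo 4, decides whether these powers of w are compared with 1 or with
    -1. *)
Lemma frobenius_fixed_odd m e : odd p -> m.-primitive_root (- t ^+ 2) ->
  (theta ^+ (p ^ e) == theta) = frobenius_fixed p m e.
Proof.
move=> op prim; have m0 := prim_order_gt0 prim.
rewrite frobenius_fixed_joukowski /frobenius_fixed.
have p2 : p != 2%N by apply: contraTneq op => ->.
have [r DQ] : exists r, (p ^ e = (2 * r).+1)%N.
  exists (p ^ e)./2; have := odd_double_half (p ^ e).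
  by rewrite oddX op orbT -mul2n add1n.
have tpow a : t ^+ (2 * a) = (-1) ^+ a * (- t ^+ 2) ^+ a.
  by rewrite -exprMn mulN1r opprK exprM.
have dvd2 a : (2 * m %| 2 * a)%N = (m %| a)%N by rewrite dvdn_pmul2l.
rewrite DQ subn1 addn1 /= -[(2 * r).+2]/(2 + 2 * r)%N -mulnS !tpow !dvd2.
have -> : ((2 * r).+1 %% 4 == 1)%N = ~~ odd r.
  by rewrite -{1}(odd_double_half r); case: (odd r); lia.
rewrite [(-1) ^+ r.+1]exprS -(signr_odd K r); case: (odd r) => /=; rewrite ?expr0 ?expr1.
  rewrite -!(prim_root_expN1 _ p2 prim) mulN1r mulN1r opprK mul1r.
  by rewrite eqr_oppLR.
rewrite mul1r mulr1 mulN1r eqr_opp.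
by rewrite !(prim_order_dvd prim).
Qed.

(** In characteristic 2 signs disappear and squaring is injective, so a power of [t] is 1 exactly
    when the same power of t^2 = -t^2 is. *)
Lemma frobenius_fixed_two m e : p = 2%N -> m.-primitive_root (- t ^+ 2) ->
  (theta ^+ (2 ^ e) == theta) = (m %| 2 ^ e - 1)%N || (m %| 2 ^ e + 1)%N.
Proof.
move=> p2 prim; rewrite -p2 frobenius_fixed_joukowski p2.
have N1 : (-1 : K) = 1 by rewrite -[LHS]oppr_pchar2 ?opprK // -p2.
have sqE (x : K) : (x ^+ 2 == 1) = (x == 1) by rewrite sqrf_eq1 N1 orbb.
rewrite N1 !(prim_order_dvd prim) -mulN1r N1 mul1r.
by rewrite -!exprM mulnC exprM sqE mulnC exprM sqE.
Qed.

End FrobeniusFixed.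

(** The degree of an irreducible factor is the length of the Frobenius orbit of a root theta, the
    least e > 0 with theta^(p^e) = theta. Since [cond] does not depend on the root, all factors
    share one degree; leaving [cond] abstract serves odd and even p alike. *)
Lemma size_irreducible_factor p m d (S : {poly 'F_p}) delta (cond : nat -> bool) :
  prime p -> ~~ (p %| m)%N -> (0 < delta)%N ->
  (forall (K : fieldType) (t theta : K) e, p \in [pchar K] ->
     t ^+ 2 - 1 = theta * t -> m.-primitive_root (- t ^+ 2) -> (0 < e)%N ->
     (theta ^+ (p ^ e) == theta) = cond e) ->
  cond delta -> (forall e, (0 < e)%N -> cond e -> (delta <= e)%N) ->
  (size S <= d.+1)%N ->
  joukowski d S %| map_poly (intr : int -> 'F_p) 'Phi_m \Po - 'X^2 ->
  forall q, irreducible_poly q -> q %| S -> size q = delta.+1.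
Proof.
move=> p_pr pm delta0 fixE cdelta min_delta sS SPhi q irrq qS.
have [K [f _]] := countable_algebraic_closure 'F_p.
have pcharK : p \in [pchar K] by rewrite (rmorph_pchar f) ?pchar_Fp.
have /closed_rootP[theta qth] : size (map_poly f q) != 1%N.
  by rewrite size_map_poly gtn_eqF // irrq.1.
have [t tE] := exists_joukowski_preimage theta.
have prim : m.-primitive_root (- t ^+ 2).
  apply: (joukowski_root_primitive (S := map_poly f S) tE (d := d)).
  - by rewrite -(dvdn_pcharf pcharK).
  - by rewrite size_map_poly.
  - rewrite -map_joukowski; have := SPhi; rewrite -(dvdp_map f).
    rewrite map_comp_poly /= rmorphN /= map_polyXn -map_poly_comp.
    by rewrite (@eq_map_poly _ _ _ intr) // => a /=; rewrite rmorph_int.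
  - by rewrite -(irreducible_dvdp_root _ irrq qth).
have [qd mind] := irreducible_dvdp_XexpBX p_pr irrq.
have qE e : (0 < e)%N -> (q %| 'X^(p ^ e) - 'X) = cond e.
  move=> e0; rewrite (irreducible_dvdp_root _ irrq qth) map_XexpBX.
  exact: fixE pcharK tE prim e0.
have sq := irrq.1; rewrite -[LHS]prednK ?(ltnW sq) //; congr _.+1.
apply/eqP; rewrite eqn_leq mind ?qE //=.
have sq0 : (0 < (size q).-1)%N by move: sq; case: (size q) => [|[]].
by rewrite min_delta // -qE.
Qed.

Lemma homogenize_factors (F : fieldType) D N delta (S : {poly F}) :
  S \is monic -> size S = D.+1 -> (0 < delta)%N ->
  (forall q, irreducible_poly q -> ~~ (q ^+ 2 %| S)) ->
  (forall q, irreducible_poly q -> q %| S -> size q = delta.+1) ->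
  exists s : seq {poly {poly F}},
    [/\ uniq s, size s = (D %/ delta)%N,
        (forall q, q \in s -> [/\ irreducible_elt q, homogeneous delta q & q \is monic]) &
        homogenize (D * N) (S ^+ N) = \prod_(q <- s) q ^+ N].
Proof.
move=> mS sS delta0 sqf sizeq; have [r rP DS] := monic_irreducible_factors mS.
have szr q : q \in r -> size q = delta.+1.
  move=> qr; apply: sizeq; first by have [] := rP q qr.
  by rewrite DS (big_rem q qr) dvdp_mulIl.
have ur : uniq r by apply: uniq_squarefree_prod => // q; rewrite -DS; apply: sqf.
have DE : D = (size r * delta)%N.
  have [|_] := @monic_prod_size F _ r xpredT (fun=> delta) id.
    by move=> q qr _; rewrite szr //; case: (rP q qr).
  by rewrite -DS sS => -[->]; rewrite big_const_seq count_predT iter_addn_0 mulnC.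
exists [seq homogenize delta q | q <- r]; split.
- rewrite map_inj_in_uniq // => q1 q2 q1r q2r /(congr1 (map_poly (horner_eval 1))).
  by rewrite !dehomogenizeK ?szr.
- by rewrite size_map DE mulnK.
- move=> _ /mapP[q qr ->]; have [mq irrq] := rP q qr; have sq := szr q qr.
  split; [exact: irreducible_homogenize| |].
    by apply: homogeneous_homogenize; rewrite sq.
  by have [] := size_homogenize_monic mq sq.
rewrite homogenizeX ?sS // big_map prodrXl; congr (_ ^+ N).
have -> : D = (\sum_(q <- r) delta)%N.
  by rewrite DE big_const_seq count_predT iter_addn_0 mulnC.
rewrite DS; apply: (@homogenize_prod _ _ r (fun=> delta) id).
by move=> q qr; rewrite szr.
Qed.

(** * Squares in characteristic 2 *)

Lemma polyFp_expp p (f : {poly 'F_p}) : prime p -> f ^+ p = f \Po 'X^p.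
Proof.
move=> p_pr; have pnat_p : [pchar {poly 'F_p}].-nat p.
  by rewrite (eq_pnat _ (pcharf_eq (pchar_polyFp p_pr))) pnat_id.
elim/poly_ind: f => [|f c IHf].
  by rewrite comp_poly0 expr0n gtn_eqF ?prime_gt0.
rewrite exprDn_pchar // exprMn IHf comp_poly_MXaddC; congr (_ + _).
by rewrite -polyC_exp; have := expFp_pfactor 1 c p_pr; rewrite expn1 => ->.
Qed.

Lemma mulrn_pchar2 (R : nzRingType) (x : R) n : 2%N \in [pchar R] ->
  x *+ n = if odd n then x else 0.
Proof.
move=> R2; rewrite -{1}(odd_double_half n) -muln2 mulrnDr mulnC mulrnA.
by rewrite (mulrn_pchar R2) mul0rn addr0; case: (odd n).
Qed.

(* In characteristic 2, with d even, X D(J_d P) = J_d(X D(P)) for the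
   derivation D, so P only has even powers as soon as J_d P is a square. *)
Lemma square_of_joukowski d (P G : {poly 'F_2}) : ~~ odd d ->
  (size P <= d.+1)%N -> joukowski d P = G ^+ 2 ->
  P = even_poly P ^+ 2.
Proof.
move=> ed sP JP; have p2 := pchar_polyFp (isT : prime 2).
have f2 := pchar_Fp (isT : prime 2).
have dX : 'X * (joukowski d P)^`() = joukowski d ('X * P^`()).
  rewrite !joukowskiE raddf_sum /= mulr_sumr; apply: eq_bigr => i _.
  rewrite derivZ derivM derivXn deriv_exp derivB derivXn -polyC1 derivC subr0 polyC1.
  (* The derivative of t^2 - 1 vanishes, so only t^(d-i) gets differentiated; as d is even, d - i
     has the parity of i, and the factor matches that of i P_i. *)
  rewrite (mulrn_pchar2 'X^(2.-1) 2 p2) /= mul0r mul0rn mulr0 addr0.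
  rewrite mulrn_pchar2 // coefXM coef_deriv oddB; last by rewrite -ltnS.
  rewrite (negPf ed) /=; case: i => -[|i] id /=.
    by rewrite mul0r scaler0 mulr0 scale0r.
  rewrite (mulrn_pchar2 P`_i.+1 i.+1 f2) /=.
  case: (boolP (odd i)) => oi /=; first by rewrite mul0r scaler0 mulr0 scale0r.
  rewrite -scalerAr mulrA -exprS; congr (_ *: ('X^_ * _)).
  rewrite prednK // subn_gt0 ltn_neqAle -ltnS id andbT.
  by apply: contraNneq ed => <-.
have sXP : (size ('X * P^`())%R <= d.+1)%N.
  have [->|P0] := eqVneq P 0; first by rewrite derivC mulr0 size_poly0.
  rewrite (leq_trans (size_polyMleq _ _)) // size_polyX /=.
  by rewrite (leq_trans (lt_size_deriv P0)).
have XP0 : 'X * P^`() = 0.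
  apply: (@joukowski_inj _ d) => //; first by rewrite size_poly0.
  rewrite -dX JP deriv_exp (mulrn_pchar2 _ 2 p2) /= mulr0.
  by rewrite joukowskiE big1 // => i _; rewrite coef0 scale0r.
rewrite polyFp_expp //; apply/polyP => i.
rewrite coef_comp_poly_Xn // coef_even_poly dvdn2.
case: (boolP (odd i)) => [oi|ei] /=; last by rewrite divn2 even_halfK.
have := congr1 (fun f : {poly 'F_2} => f`_i) XP0.
rewrite coef0 coefXM coef_deriv; case: i oi => // i oi /=.
by rewrite (mulrn_pchar2 _ i.+1 f2) oi.
Qed.

(** * Reduction of the fibotomic polynomials modulo p, case by case *)

Lemma fibotomic_sol_pfactor p k m S T :
  prime p -> (0 < m)%N -> coprime p m ->
  fibotomic_sol m S -> fibotomic_sol (p ^ k * m) T ->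
  map_poly (intr : int -> 'F_p) T = map_poly intr S ^+ totient (p ^ k).
Proof.
move=> p_pr m0 co_pm mS mT.
have totE : totient (p ^ k * m) = (totient m * totient (p ^ k))%N.
  by rewrite totient_coprime ?coprimeXl // mulnC.
have sS := size_map_fibotomic_sol 'F_p mS; have sT := size_map_fibotomic_sol 'F_p mT.
case: mS mT => _ _ JS [_ _ JT].
apply: (@joukowski_inj _ (totient (p ^ k * m))); first by rewrite sT.
  by rewrite totE (leq_trans (size_poly_exp_leq _ _)) // sS.
rewrite -map_joukowski JT twisted_cyclotomic_pfactor // totE.
by rewrite joukowski_exp ?sS // -map_joukowski JS.
Qed.

Lemma homogenize_polyX (R : nzRingType) : homogenize 1 ('X : {poly R}) = 'X.
Proof.
rewrite /homogenize poly_def !big_ord_recl big_ord0 !coefX /= scale0r scale1r.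
by rewrite scale0r add0r addr0 expr0 scale1r.
Qed.

Lemma homogenize_X2DC (R : nzRingType) (c : R) :
  homogenize 2 ('X^2 + c%:P) = 'X^2 + c%:P%:P * yvar R ^+ 2.
Proof.
apply/polyP => i; rewrite coef_poly !coefD !coefXn !coefC /yvar -polyC_exp -polyCM coefC.
case: i => [|[|[|i]]] //=; rewrite ?add0r ?addr0 ?scale0r //.
  by rewrite subn0 mul_polyC.
by rewrite scale1r.
Qed.

(** This is (t - 1/t)^2 + 4 = (t + 1/t)^2, the origin of the constant 4. *)
Lemma joukowski_X2D4 (R : comNzRingType) :
  joukowski 2 ('X^2 + 4%:R%:P : {poly R}) = ('X^2 + 1) ^+ 2.
Proof.
rewrite joukowskiE !big_ord_recl big_ord0 !coefD !coefXn !coefC /=.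
rewrite !add0r !addr0 scale0r scale1r add0r expr0 mul1r mulr1 /bump /=.
by rewrite scaler_nat; ring.
Qed.

Lemma size_X2DC (R : nzRingType) (c : R) : size ('X^2 + c%:P) = 3%N.
Proof. by rewrite -[c]opprK polyCN size_XnsubC. Qed.

Section FibotomicModp.

Variables (p m k : nat) (S T : {poly int}).
Hypotheses (p_pr : prime p) (co_pm : coprime p m).
Hypothesis ST : fibotomic_sol (p ^ k * m) T.

Let H : {poly {poly 'F_p}} :=
  homogenize (totient (p ^ k * m)) (map_poly (intr : int -> 'F_p) T).

(** As n = 1 has no solution polynomial to take powers of, the comparison happens on images, where
    (t^2 + 1)^phi(p^k) must be recognized. The exponent is even, and x^2 + 4 applies, unless p^k =
    2; in that case t^2 + 1 = t^2 - 1 is the image of x. *)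
Lemma fibotomic_modp_m1 : m = 1%N -> (2 <= p ^ k * m)%N ->
  H = if (p == 2%N) && (k == 1%N) then 'X
      else ('X ^+ 2 + 4%:R * yvar 'F_p ^+ 2) ^+ (totient (p ^ k) %/ 2).
Proof.
move=> m1 pk2; have sT := size_map_fibotomic_sol 'F_p ST.
have JT : joukowski (totient (p ^ k)) (map_poly (intr : int -> 'F_p) T)
    = ('X^2 + 1) ^+ totient (p ^ k).
  have [_ _] := ST; rewrite -map_joukowski m1 muln1 => ->.
  rewrite -[X in twisted_cyclotomic X]muln1 twisted_cyclotomic_pfactor ?coprimen1 //.
  by rewrite twisted_cyclotomic1 rmorphD rmorph1 /= map_polyXn.
rewrite /H; move: sT JT; rewrite m1 muln1 in pk2 *; move: (map_poly _ T) => U sU JU.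
case: ifP => [/andP[/eqP p2 /eqP k1]|nC].
  subst p k; have -> : U = 'X.
    apply: (@joukowski_inj _ 1); rewrite ?sU ?size_polyX // JU joukowskiX1 expr1.
    congr (_ + _); apply/polyP => i; rewrite coefN coef1.
    by case: i => [|i] /=; [apply: val_inj | rewrite oppr0].
  exact: homogenize_polyX.
have et : (totient (p ^ k) = 2 * (totient (p ^ k) %/ 2))%N.
  have k0 : (0 < k)%N by case: k pk2.
  rewrite mulnC divnK // totient_pfactor // dvdn2 oddM oddX.
  have [p2|op] := even_prime p_pr.
    move: nC; rewrite p2 /= orbF; case: (k) k0 => [|[|k']] //.
  by rewrite -subn1 oddB ?prime_gt0 // op.
set h := (totient (p ^ k) %/ 2)%N in et *.
have -> : U = ('X^2 + 4%:R%:P) ^+ h.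
  apply: (@joukowski_inj _ (2 * h)); first by rewrite sU et.
    by rewrite (leq_trans (size_poly_exp_leq _ _)) // size_X2DC.
  by rewrite joukowski_exp ?size_X2DC // joukowski_X2D4 -exprM -et JU et.
by rewrite et homogenizeX ?size_X2DC // homogenize_X2DC !rmorph_nat.
Qed.

Hypothesis SS : fibotomic_sol m S.
Hypothesis m_gt0 : (0 < m)%N.

Let U := map_poly (intr : int -> 'F_p) S.

Let sU : size U = (totient m).+1.
Proof. exact: size_map_fibotomic_sol. Qed.

Let mU : U \is monic.
Proof.
have [mS sS _] := SS; rewrite monicE lead_coefE sU coef_map /=.
by have := monicP mS; rewrite lead_coefE sS /= => ->.
Qed.

Let JU : joukowski (totient m) U = map_poly intr (twisted_cyclotomic m).
Proof. by have [_ _ JS] := SS; rewrite -map_joukowski JS. Qed.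

Let UPhi : joukowski (totient m) U %| map_poly (intr : int -> 'F_p) 'Phi_m \Po - 'X^2.
Proof. exact: dvdp_fibotomic_sol. Qed.

Let HE n d V : U = V ^+ n -> totient m = (d * n)%N ->
  H = homogenize (d * (n * totient (p ^ k))) (V ^+ (n * totient (p ^ k))).
Proof.
move=> UV md; rewrite /H (fibotomic_sol_pfactor p_pr m_gt0 co_pm SS ST).
rewrite -/U UV -exprM; congr homogenize.
by rewrite totient_coprime ?coprimeXl // mulnC md mulnA.
Qed.

Let HU : H = homogenize (totient m * totient (p ^ k)) (U ^+ totient (p ^ k)).
Proof. by rewrite (@HE 1 (totient m) U) ?mul1n ?muln1. Qed.

Lemma fibotomic_modp_m2 : m = 2%N -> S = 'X -> H = 'X ^+ totient (p ^ k).
Proof.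
move=> m2 SX; rewrite HU homogenizeX ?sU // /U SX m2 /= map_polyX; congr (_ ^+ _).
exact: homogenize_polyX.
Qed.

Lemma fibotomic_modp_odd : (3 <= m)%N -> (2 < p)%N ->
  exists s : seq {poly {poly 'F_p}},
    [/\ uniq s, size s = (totient m %/ delta_odd p m)%N,
        (forall q, q \in s -> [/\ irreducible_elt q,
            homogeneous (delta_odd p m) q & q \is monic]) &
        H = \prod_(q <- s) q ^+ totient (p ^ k)].
Proof.
move=> m3 p3; have op : odd p by case: (even_prime p_pr) p3 => [->|].
have pm : ~~ (p %| m)%N by rewrite -prime_coprime.
have [delta0 fdelta min_delta] := delta_odd_min op m3 co_pm.
have sep : separable_poly (joukowski (totient m) U).
  rewrite JU separable_twisted_cyclotomic // -(dvdn_pcharf (pchar_Fp p_pr)).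
  by rewrite Euclid_dvdM // negb_or pm dvdn_prime2 // gtn_eqF.
rewrite HU; apply: homogenize_factors => //.
  by apply: separable_joukowski_squarefree sep; rewrite sU.
apply: (size_irreducible_factor p_pr pm delta0 _ fdelta min_delta _ UPhi).
  move=> K t theta e pcharK tE prim _.
  exact: (frobenius_fixed_odd pcharK tE _ op prim).
by rewrite sU.
Qed.

End FibotomicModp.

Lemma even_totient_odd (m : nat) : (2 < m)%N -> odd m -> ~~ odd (totient m).
Proof.
move=> m2 om; have q_pr := pdiv_prime (ltnW m2); set q := pdiv m in q_pr.
have m0 : (0 < m)%N by apply: ltn_trans m2.
have oq : odd q by have := dvdn_odd (pdiv_dvd m) om.
have lq : (0 < logn q m)%N by rewrite logn_gt0 mem_primes q_pr m0 pdiv_dvd.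
have [m' co_qm' ->] := pfactor_coprime q_pr m0.
rewrite totient_coprime ?coprimeXr 1?coprime_sym // oddM totient_pfactor // oddM.
by rewrite -subn1 oddB ?prime_gt0 // oq /= andbF.
Qed.

(** Modulo 2 the image of Psi_m is Phi_m(t^2) = Phi_m(t)^2, which is not separable, so the argument
    runs on the square root [R]. By injectivity of squaring its image is Phi_m, a factor of the
    separable t^m - 1; its degree phi(m)/2 accounts for the halved number of factors. *)
Lemma fibotomic_modp_two (m k : nat) (S T : {poly int}) :
  (3 <= m)%N -> coprime 2 m ->
  fibotomic_sol m S -> fibotomic_sol (2 ^ k * m) T ->
  exists s : seq {poly {poly 'F_2}},
    [/\ uniq s, size s = (totient m %/ (2 * delta_two m))%N,
        (forall q, q \in s -> [/\ irreducible_elt q,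
            homogeneous (delta_two m) q & q \is monic]) &
        homogenize (totient (2 ^ k * m)) (map_poly (intr : int -> 'F_2) T)
          = \prod_(q <- s) q ^+ (2 * totient (2 ^ k))].
Proof.
move=> m3 co_2m SS ST; have p_pr : prime 2 by [].
have om : odd m by rewrite -coprime2n.
have pm : ~~ (2 %| m)%N by rewrite dvdn2 om.
have [delta0 fdelta min_delta] := delta_two_min m3 om.
pose U := map_poly (intr : int -> 'F_2) S.
have [mS sS JS] := SS; have sU : size U = (totient m).+1 by apply: size_map_fibotomic_sol.
have m0 : (0 < m)%N by apply: ltn_trans m3.
have et := even_totient_odd m3 om.
pose G := map_poly (intr : int -> 'F_2) 'Phi_m.
have p2 := pchar_polyFp p_pr.
have JU : joukowski (totient m) U = G ^+ 2.
  rewrite -map_joukowski JS map_twisted_cyclotomic -signr_odd (negPf et) scale1r.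
  by rewrite oppr_pchar2 // (polyFp_expp G).
have UR : U = even_poly U ^+ 2 by apply: square_of_joukowski et _ JU; rewrite sU.
set R := even_poly U in UR.
have mU : U \is monic.
  rewrite monicE lead_coefE sU coef_map /=.
  by have := monicP mS; rewrite lead_coefE sS /= => ->.
have mR : R \is monic.
  have := monicP mU; rewrite UR expr2 lead_coefM -expr2.
  by have := expFp_pfactor 1 (lead_coef R) p_pr; rewrite expn1 => -> /eqP.
have sR : size R = (totient m %/ 2).+1.
  have := sU; rewrite UR expr2 size_Mmonic ?monic_neq0 // divn2.
  have : (0 < size R)%N by rewrite size_poly_gt0 monic_neq0.
  case: (size R) => // r _; rewrite addSn addnS /= => -[<-].
  by rewrite addnn doubleK.
set d := (totient m %/ 2)%N in sR.
have md : totient m = (d * 2)%N by rewrite divnK // dvdn2.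
have JR : joukowski d R ^+ 2 = G ^+ 2 by rewrite -joukowski_exp ?sR // -md -UR.
have GJ : joukowski d R = G.
  by apply/eqP; have /eqP := JR; rewrite eqf_sqr oppr_pchar2 // orbb.
have sepG : separable_poly G.
  have sepX : separable_poly ('X^m - 1 : {poly 'F_2}).
    by apply: separable_Xn_sub_1; rewrite -(dvdn_pcharf (pchar_Fp p_pr)).
  apply: dvdp_separable sepX.
  have := congr1 (map_poly (intr : int -> 'F_2)) (prod_Cyclotomic m0).
  rewrite (big_rem m) -?dvdn_divisors //= rmorphM rmorphB rmorph1 /= map_polyXn => <-.
  exact: dvdp_mulIl.
have RPhi : joukowski d R %| G \Po - 'X^2.
  by rewrite oppr_pchar2 // -(polyFp_expp G) // GJ expr2 dvdp_mulIl.
have [s [us ss sP Hs]] : exists s : seq {poly {poly 'F_2}},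
    [/\ uniq s, size s = (d %/ delta_two m)%N,
        (forall q, q \in s -> [/\ irreducible_elt q,
            homogeneous (delta_two m) q & q \is monic]) &
        homogenize (d * (2 * totient (2 ^ k))) (R ^+ (2 * totient (2 ^ k)))
          = \prod_(q <- s) q ^+ (2 * totient (2 ^ k))].
  apply: homogenize_factors => //.
    by apply: (separable_joukowski_squarefree (d := d)); rewrite ?sR ?GJ.
  apply: (size_irreducible_factor p_pr pm delta0 _ fdelta min_delta _ RPhi).
    by move=> K t theta e pcharK tE prim _; apply: (frobenius_fixed_two pcharK tE).
  by rewrite sR.
exists s; split=> //; first by rewrite ss divnMA.
rewrite -Hs (fibotomic_sol_pfactor p_pr m0 co_2m SS ST) -/U {1}UR -exprM.
by rewrite totient_coprime ?coprimeXl // mulnC md mulnA.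
Qed.

Theorem theorem3 (p m k : nat) (Psi : {poly int}) :
  prime p -> (0 < m)%N -> coprime p m -> (2 <= p ^ k * m)%N ->
  is_fibotomic (p ^ k * m) Psi ->
  let H : {poly {poly 'F_p}} :=
    homogenize (totient (p ^ k * m)) (map_poly (intr : int -> 'F_p) Psi) in
  [/\ m = 1%N ->
        H = (if (p == 2%N) && (k == 1%N) then 'X
             else ('X ^+ 2 + 4%:R * yvar 'F_p ^+ 2) ^+ (totient (p ^ k) %/ 2)),
      m = 2%N -> H = 'X ^+ totient (p ^ k),
      (3 <= m)%N -> (2 < p)%N ->
        exists s : seq {poly {poly 'F_p}},
          [/\ uniq s, size s = (totient m %/ delta_odd p m)%N,
              (forall q, q \in s -> [/\ irreducible_elt q,
                  homogeneous (delta_odd p m) q & q \is monic]) &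
              H = \prod_(q <- s) q ^+ totient (p ^ k)] &
      (3 <= m)%N -> p = 2%N ->
        exists s : seq {poly {poly 'F_p}},
          [/\ uniq s, size s = (totient m %/ (2 * delta_two m))%N,
              (forall q, q \in s -> [/\ irreducible_elt q,
                  homogeneous (delta_two m) q & q \is monic]) &
              H = \prod_(q <- s) q ^+ (2 * totient (p ^ k))]].

Proof.
move=> p_pr m0 co_pm n2 fibPsi H.
have [S SP] := fibotomic_sol_exists (p ^ k * m).
have PsiE : Psi = S (p ^ k * m)%N by apply: is_fibotomic_sol fibPsi.
have solPsi : fibotomic_sol (p ^ k * m) Psi by rewrite PsiE; apply: SP; rewrite n2 /=.
have mn : (m <= p ^ k * m)%N by rewrite leq_pmull // expn_gt0 prime_gt0.
have solm : (1 < m)%N -> fibotomic_sol m (S m) by move=> m1; apply: SP; rewrite m1.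
split=> [m1|m2|m3 p3|m3 p2].
- exact: fibotomic_modp_m1 solPsi m1 n2.
- have m1 : (1 < m)%N by rewrite m2.
  (* The product for F_2 = x over the divisors of 2 other than 1 has the single factor [S 2]. *)
  have Sm : S m = 'X.
    have := fibpoly_prod SP (leq_trans m1 mn).
    rewrite (_ : divisors 2 = [:: 1%N; 2%N]) // !big_cons big_nil /= mulr1 m2 => <-.
    by rewrite fibpolyS mulr1 addr0.
  exact: fibotomic_modp_m2 p_pr co_pm solPsi (solm m1) m0 m2 Sm.
- exact: fibotomic_modp_odd (solm (ltnW m3)) m0 m3 p3.
- subst p; exact: fibotomic_modp_two m3 co_pm (solm (ltnW m3)) solPsi.
Qed.
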